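(* Let $s_1\ge s_2\ge1$ be coprime integers and let $P(x,y)\,dy-Q(x,y)\,dx=0$ be an $(s_1,s_2)$-quasi-homogeneous real polynomial foliation, the pull-back of the homogeneous foliation $P^*(x,y)\,dy-Q^*(x,y)\,dx=0$ under the map $(x,y)\mapsto(x^{s_2},y^{s_1})$. Then the foliation $P\,dy-Q\,dx=0$ has a center (at the origin) if and only if one of the following conditions is satisfied: (i) $s_1,s_2$ are odd and the homogeneous foliation $P^*\,dy-Q^*\,dx=0$ has a center; or (ii) one of the weights $s_1,s_2$ is odd, the other is even, and the homogeneous foliation $P^*\,dy-Q^*\,dx=0$ has a center or a focus.
   Context: The foliation $P\,dy-Q\,dx=0$ is $(s_1,s_2)$-quasi-homogeneous if it is invariant under all maps $(x,y)\mapsto(\lambda^{s_1}x,\lambda^{s_2}y)$, $\lambda>0$; equivalently $P(\lambda^{s_1}x,\lambda^{s_2}y)=\lambda^{d_1}P$, $Q(\lambda^{s_1}x,\lambda^{s_2}y)=\lambda^{d_2}Q$ with $d_2+s_1=d_1+s_2$. It is known that every such foliation is the pull-back of a homogeneous foliation $P^*\,dy-Q^*\,dx=0$ ($P^*,Q^*$ homogeneous polynomials of the same degree) under $(x,y)\mapsto(x^{s_2},y^{s_1})$: the pulled-back one-form is a non-zero multiple of $P\,dy-Q\,dx$. Foliations are considered up to multiplication of the defining one-form by a non-zero rational function (so common factors of the coefficients may be removed). A foliation has a center (resp. focus) at the origin if in a punctured neighborhood of the origin all leaves are closed curves around the origin (resp. spirals tending to the origin). *)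

(* Defs.v *)
From HB Require Import structures.
(* mpoly has to be imported before the analysis libraries: in the other order
   their notations are rejected. *)
From mathcomp Require Import all_boot all_order all_algebra.
From mathcomp Require Import mpoly.
From mathcomp Require Import all_classical all_reals all_analysis.

Set Implicit Arguments.
Unset Strict Implicit.
Unset Printing Implicit Defensive.

Import Order.TTheory GRing.Theory Num.Theory.
Import numFieldNormedType.Exports.

Local Open Scope classical_set_scope.
Local Open Scope ring_scope.

(* The pair (P, Q) stands for the polynomial one-form P dy - Q dx, where
   x = 'X_0 and y = 'X_1. *)
Definition oneform (R : realType) : Type := ({mpoly R[2]} * {mpoly R[2]})%type.

Definition evalxy (R : realType) (p : {mpoly R[2]}) (a : R * R) : R :=
  p.@[fun i : 'I_2 => if i == 0 then a.1 else a.2].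

(* w' = (A / B) w for a non-zero rational function A / B. *)
Definition same_foliation (R : realType) (w w' : oneform R) : Prop :=
  exists A B : {mpoly R[2]},
    [/\ A != 0, B != 0, A * w.1 = B * w'.1 & A * w.2 = B * w'.2].

(* Pull-back under (x, y) |-> (f, g):
   P(f, g) dg - Q(f, g) df
     = (P(f, g) g_y - Q(f, g) f_y) dy - (Q(f, g) f_x - P(f, g) g_x) dx. *)
Definition pullback (R : realType) (f g : {mpoly R[2]}) (w : oneform R) :
    oneform R :=
  let P := w.1 \mPo [tuple f; g] in
  let Q := w.2 \mPo [tuple f; g] in
  (P * g^`M(1) - Q * f^`M(1), Q * f^`M(0) - P * g^`M(0)).

Definition quasi_homogeneous (R : realType) (s1 s2 : nat) (w : oneform R) :
    Prop :=
  forall l : R, 0 < l ->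
    same_foliation (pullback (l ^+ s1 *: 'X_0) (l ^+ s2 *: 'X_1) w) w.

(* The vector u is tangent at a to the foliation of w.  Forms are taken up to
   rational multiples, so the singular points are those at which every
   polynomial form of the foliation vanishes; two of its forms that do not
   vanish at a define the same line there. *)
Definition tangent (R : realType) (w : oneform R) (a u : R * R) : Prop :=
  exists w' : oneform R,
    [/\ same_foliation w w',
        (evalxy w'.1 a != 0) || (evalxy w'.2 a != 0) &
        evalxy w'.1 a * u.2 - evalxy w'.2 a * u.1 = 0].

(* A C^1 regular parametrized curve t |-> (x t, y t), t in R, that lies in U,
   avoids the singular points and runs along a leaf. *)
Definition leaf_curve (R : realType) (w : oneform R) (U : set (R * R))
    (x y : R -> R) : Prop :=
  [/\ forall t : R, derivable x t 1 /\ derivable y t 1,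
      continuous (derive1 x) /\ continuous (derive1 y),
      forall t : R, (derive1 x t != 0) || (derive1 y t != 0),
      forall t : R, U (x t, y t) &
      forall t : R, tangent w (x t, y t) (derive1 x t, derive1 y t)].

Definition angle_along (R : realType) (x y theta : R -> R) : Prop :=
  continuous theta /\
  forall t : R, exists r : R,
    [/\ 0 < r, x t = r * cos (theta t) & y t = r * sin (theta t)].

(* A simple closed curve whose winding number around the origin is not 0. *)
Definition closed_around_origin (R : realType) (x y : R -> R) : Prop :=
  exists (T : R) (theta : R -> R),
    [/\ 0 < T,
        forall t : R, x (t + T) = x t /\ y (t + T) = y t,
        {in `[0, T[ &, injective (fun t : R => (x t, y t))},
        angle_along x y theta &
        theta T != theta 0].

Definition spirals_to_origin (R : realType) (x y : R -> R) : Prop :=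
  exists theta : R -> R,
    [/\ angle_along x y theta,
        x t @[t --> +oo] --> (0 : R),
        y t @[t --> +oo] --> (0 : R) &
        theta t @[t --> +oo] --> +oo \/ theta t @[t --> +oo] --> -oo].

(* C holds for a parametrization of the leaf through each point of a punctured
   neighborhood of the origin, the foliation being restricted to that
   neighborhood.  Leaves through regular points are unique, so a closed leaf
   curve is a whole leaf; a spiraling leaf curve is an end of the leaf, in
   either of its two orientations. *)
Definition all_leaves_near_origin (R : realType) (w : oneform R)
    (C : (R -> R) -> (R -> R) -> Prop) : Prop :=
  exists2 U : set (R * R), nbhs ((0 : R), (0 : R)) U &
    forall a : R * R, U a -> a <> (0, 0) ->
      exists x y : R -> R,
        [/\ leaf_curve w (U `\ (0, 0)) x y,
            exists t : R, (x t, y t) = a &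
            C x y].

Definition has_center (R : realType) (w : oneform R) : Prop :=
  all_leaves_near_origin w (@closed_around_origin R).

Definition has_focus (R : realType) (w : oneform R) : Prop :=
  all_leaves_near_origin w (@spirals_to_origin R).

(* Main.v *)
(* A real-reduced homogeneous form w0 represents the homogeneous foliation: only
   common factors with a real zero have to be divided out.

   If x Q0 - y P0 vanishes on a line b x = a y, then b x^s2 = a y^s1 (or a
   coordinate axis) is invariant for the pull-back. Since one of the weights is
   odd, it separates two opposite half-axes, so a leaf winding around the origin
   would meet it, hence lie in it, which is impossible.

   Otherwise a leaf of the pull-back is x = l^s1 cos t, y = l^s2 sin t, where
   log l is a primitive of a periodic function; it closes up when the increment J
   of the primitive over a period is 0 and spirals otherwise. Pushing this leaf
   forward by (x, y) |-> (x^s2, y^s1) gives s1 s2 J = k J1, where J1 is the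
   increment of the homogeneous foliation and k is the winding number of
   (cos^s2 t, sin^s1 t): k = 1 for odd weights, while k = 0 if one weight is
   even, as the curve then stays in a half-plane. *)
Require Import Defs.
From mathcomp Require Import all_boot all_order all_algebra.
From mathcomp Require Import mpoly.
From mathcomp Require Import all_classical all_reals all_analysis.
From mathcomp Require Import ring lra zify.

Import Order.TTheory GRing.Theory Num.Theory.
Import numFieldNormedType.Exports.
Local Open Scope classical_set_scope.
Local Open Scope ring_scope.

Set Implicit Arguments.
Unset Strict Implicit.
Unset Printing Implicit Defensive.

(** An arbitrary leaf of a center is never identified with a quasi-polar curve. Instead,
    [radial_growth] is a conservation law along every curve tangent to the homogeneous form, and it
    does not ask the parametrization to be regular: the push-forward of a leaf by (x, y) |-> (x^s2,
    y^s1) may stop where it meets an axis. Winding numbers of pushed-forward curves are not computed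
    directly. The law takes a comparison angle [th] whose direction has non-negative scalar product
    with the curve, and a difference of angles with non-negative cosine cannot make a turn. Three
    choices suffice: the parameter t for odd weights, a constant for weights of opposite parity, and
    the leaf's own angle for a closed leaf. That a leaf meeting an invariant curve f = 0 lies in it
    is a uniqueness statement; it comes from an equation f' = h f near each zero and a Gronwall
    estimate. Dividing by real lines only is enough because two forms of one foliation are parallel
    at every point, so any form that does not vanish at a point gives the tangent there. *)

Section Calculus.
Variable R : realType.
Implicit Types (f g h : R -> R) (t : R).

(** * Pointwise rules for derivatives and continuity, and primitives *)

Lemma is_derive_continuous {f t d} :
  is_derive t 1 f d -> {for t, continuous f}.
Proof.
by move=> fd; apply/differentiable_continuous/derivable1_diffP; case: fd.
Qed.

Lemma is_derive_ext {f g t df dg} : is_derive t 1 f df ->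
  (forall s, g s = f s) -> dg = df -> is_derive t 1 g dg.
Proof. by move=> fd /funext -> ->. Qed.

Lemma is_derive_fM {f g t df dg} : is_derive t 1 f df -> is_derive t 1 g dg ->
  is_derive t 1 (fun s => f s * g s) (df * g t + f t * dg).
Proof.
move=> fd gd; have := is_deriveM fd gd.
by rewrite /GRing.scale /= addrC [g t * _]mulrC.
Qed.

Lemma is_derive_fD {f g t df dg} : is_derive t 1 f df -> is_derive t 1 g dg ->
  is_derive t 1 (fun s => f s + g s) (df + dg).
Proof. by move=> fd gd; exact: is_deriveD. Qed.

Lemma is_derive_fB {f g t df dg} : is_derive t 1 f df -> is_derive t 1 g dg ->
  is_derive t 1 (fun s => f s - g s) (df - dg).
Proof. by move=> fd gd; exact: is_deriveB. Qed.

Lemma is_derive_fX n {f t df} : is_derive t 1 f df ->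
  is_derive t 1 (fun s => f s ^+ n) (n%:R * f t ^+ n.-1 * df).
Proof.
move=> fd; have -> : (fun s => f s ^+ n) = f ^+ n.
  by elim: n => [|n IH]; apply/funext => s; rewrite ?expr0// !exprS -IH.
exact: is_deriveX.
Qed.

Lemma is_derive_fexp {f t df} : is_derive t 1 f df ->
  is_derive t 1 (fun s => expR (f s)) (expR (f t) * df).
Proof.
move=> fd; exact: is_derive1_comp.
Qed.

Lemma is_derive_fcos {f t df} : is_derive t 1 f df ->
  is_derive t 1 (fun s => cos (f s)) (- sin (f t) * df).
Proof. by move=> fd; exact: is_derive1_comp. Qed.

Lemma is_derive_fsin {f t df} : is_derive t 1 f df ->
  is_derive t 1 (fun s => sin (f s)) (cos (f t) * df).
Proof. by move=> fd; exact: is_derive1_comp. Qed.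

Lemma is_derive_fcomp {f g t df dg} : is_derive t 1 g dg ->
  is_derive (g t) 1 f df -> is_derive t 1 (fun s => f (g s)) (df * dg).
Proof. by move=> gd fd; exact: is_derive1_comp. Qed.

Lemma is_derive_const (c : R) t : is_derive t 1 (fun=> c) 0.
Proof. exact: is_derive_cst. Qed.

Lemma is_derive_ident t : is_derive t (1 : R) (fun s => s) 1.
Proof. exact: is_derive_id. Qed.

Lemma continuous_fD f g : continuous f -> continuous g ->
  continuous (fun s => f s + g s).
Proof. by move=> cf cg t; apply: cvgD; [exact: cf|exact: cg]. Qed.

Lemma continuous_fB f g : continuous f -> continuous g ->
  continuous (fun s => f s - g s).
Proof. by move=> cf cg t; apply: cvgB; [exact: cf|exact: cg]. Qed.

Lemma continuous_fM f g : continuous f -> continuous g ->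
  continuous (fun s => f s * g s).
Proof. by move=> cf cg t; apply: cvgM; [exact: cf|exact: cg]. Qed.

Lemma continuous_fX n f : continuous f -> continuous (fun s => f s ^+ n).
Proof.
move=> cf; elim: n => [|n IH]; first by move=> t; exact: cvg_cst.
have -> : (fun s => f s ^+ n.+1) = (fun s => f s * f s ^+ n).
  by apply/funext => s; rewrite exprS.
exact: continuous_fM.
Qed.

Lemma continuous_fV f : continuous f -> (forall t, f t != 0) ->
  continuous (fun s => (f s)^-1).
Proof. by move=> cf f0 t; apply: cvgV => //; exact: cf. Qed.

Lemma continuous_fcomp f g : continuous f -> continuous g ->
  continuous (fun s => g (f s)).
Proof. by move=> cf cg t; apply: continuous_comp; [exact: cf|exact: cg]. Qed.

Lemma derive0_const f : (forall t, is_derive t 1 f 0) -> forall s t, f s = f t.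
Proof. by move=> fd s t; exact: is_derive_0_is_cst. Qed.

Lemma is_derive_const_on f (a : R) : (forall t, a < t -> is_derive t 1 f 0) ->
  forall s t, a < s -> a < t -> f s = f t.
Proof.
move=> fd.
have le s t : a < s -> s <= t -> f s = f t.
  move=> ltas st.
  have d0 x : x \in `]s, t[ -> is_derive x 1 f ((fun=> 0) x).
    by rewrite in_itv/= => /andP[sx _]; apply: fd; exact: lt_trans sx.
  have cf : {within `[s, t], continuous f}%classic.
    apply: derivable_within_continuous => x; rewrite in_itv/= => /andP[sx _].
    by have := fd x (lt_le_trans ltas sx); case.
  have [_ _] := MVT_segment st d0 cf.
  by rewrite mul0r => /eqP; rewrite subr_eq0 => /eqP.
move=> s t ltas ltat; case: (leP s t) => st; first exact: le.
by apply/esym/le => //; exact: ltW.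
Qed.

(** Integration starts at a fixed left endpoint, so one integral is a primitive only to the right of
    [a]; [antiderivative] glues these. *)
Lemma antiderivative_right (h : R -> R) (a : R) : continuous h ->
  exists g, forall t, a < t -> is_derive t 1 g (h t).
Proof.
move=> ch; exists (fun t => (\int[lebesgue_measure]_(s in `[a, t]%classic) h s)%R).
move=> t ltat.
have ih : lebesgue_measure.-integrable `[a, t + 1]%classic (EFin \o h).
  apply: continuous_compact_integrable; first exact: segment_compact.
  exact: continuous_subspaceT.
have lt1 : t < t + 1 by rewrite ltrDl.
have [d1 d2] := continuous_FTC1_closed lt1 ih ltat (ch t).
by apply: DeriveDef => //; rewrite -derive1E.
Qed.

Lemma antiderivative (h : R -> R) : continuous h ->
  exists g, g 0 = 0 /\ forall t, is_derive t 1 g (h t).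
Proof.
move=> ch.
have [G GP] := choice (fun a => antiderivative_right a ch).
pose g t := G (- (`|t| + 1)) t - G (- (`|t| + 1)) 0.
(* All base points to the left of -|t| give the same normalized value, because two such primitives
   differ by a constant on an interval containing 0 and [t]. Near [t] a single base point therefore
   serves. *)
have gE (b t : R) : `|t| < b -> g t = G (- b) t - G (- b) 0.
  move=> tb; rewrite /g; set c := `|t| + 1.
  have c0 : 0 < c by rewrite /c; have := normr_ge0 t; lra.
  have b0 : 0 < b by apply: le_lt_trans tb.
  have tl := ler_norm (- t); rewrite normrN in tl.
  pose m := Num.min b c.
  have := @is_derive_const_on (fun s => G (- c) s - G (- b) s) (- m) _ 0 t.
  have mb : m <= b by rewrite ge_min lexx.
  have mc : m <= c by rewrite ge_min lexx orbT.
  have m0 : 0 < m by rewrite lt_min b0.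
  have mt : `|t| < m by rewrite lt_min tb /c/=; lra.
  have H (s : R) : - m < s -> is_derive s 1 (fun s => G (- c) s - G (- b) s) 0.
    move=> ms; rewrite -(subrr (h s)).
    by apply: is_derive_fB; apply: GP; lra.
  by move=> /(_ H); rewrite /=; lra.
exists g; split; first by rewrite /g subrr.
move=> t; apply: (@near_eq_is_derive _ _ _
  (fun s => G (- (`|t| + 1)) s - G (- (`|t| + 1)) 0)).
- near=> s; rewrite (gE (`|t| + 1))//.
  have : `|t - s| < 1 by near: s; exact: cvgr_dist_lt.
  by have := ler_normB t (t - s); rewrite opprB addrC subrK; lra.
- rewrite -[h t]subr0; apply: (is_derive_fB _ (is_derive_const _ _)).
  by apply: GP; have := ler_norm (- t); rewrite normrN; lra.
Unshelve. all: by end_near. Qed.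

End Calculus.

(** * Continuous angles along plane curves and their turns *)

Section Angles.
Variable R : realType.
Implicit Types (f g X Y dX dY : R -> R) (s t x y : R).

Lemma IVT_unordered f s t v : continuous f -> f s <= v <= f t ->
  exists c, f c = v.
Proof.
move=> cf /andP[sv vt].
have ivt a b : a <= b -> Num.min (f a) (f b) <= v <= Num.max (f a) (f b) ->
    exists c, f c = v.
  move=> ab abv; have [c _ <-] := IVT ab (continuous_subspaceT cf) abv.
  by exists c.
case: (leP s t) => [st|/ltW ts].
- by apply: (ivt s t) => //; rewrite ge_min sv le_max vt orbT.
- by apply: (ivt t s) => //; rewrite ge_min sv le_max vt orbT.
Qed.

(** With [J] = 0 this also covers periodic functions such as cos and sin. *)
Lemma quasi_periodic_int g (p J : R) : (forall t, g (t + p) = g t + J) ->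
  forall (k : int) t, g (t + k%:~R * p) = g t + k%:~R * J.
Proof.
move=> gp.
have nat_case (n : nat) t : g (t + n%:R * p) = g t + n%:R * J.
  elim: n => [|n IH]; first by rewrite !mul0r !addr0.
  by rewrite -natr1 mulrDl mul1r addrA gp IH mulrDl mul1r addrA.
case=> n t; first exact: nat_case.
rewrite NegzE mulrNz !mulNr.
by rewrite -[in RHS](subrK (n.+1%:R * p) t) nat_case addrK.
Qed.

Lemma cos_eq1 x : cos x = 1 -> exists k : int, x = k%:~R * (pi *+ 2).
Proof.
move=> x1.
have p0 : 0 < pi *+ 2 :> R by rewrite pmulrn_lgt0// pi_gt0.
pose k := Num.floor (x / (pi *+ 2)); exists k.
pose y := x - k%:~R * (pi *+ 2).
have /andP[k1 k2] := floor_itv (x / (pi *+ 2)).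
have y0 : 0 <= y by rewrite /y subr_ge0 -ler_pdivlMr.
have y1 : y < pi *+ 2.
  by move: k2; rewrite intrD ltr_pdivrMr// /y; lra.
have cy : cos y = 1.
  have per u : cos (u + pi *+ 2) = cos u + 0 :> R by rewrite addr0 cosD2pi.
  by rewrite -x1 -(subrK (k%:~R * (pi *+ 2)) x) (quasi_periodic_int per) mulr0 addr0.
suff yE : y = 0 by move/eqP: yE; rewrite subr_eq0 => /eqP.
apply/eqP; rewrite eq_le y0 andbT leNgt; apply/negP => yp.
(* The half angle lies strictly between 0 and pi, while cos y = 1 forces its sine to vanish. *)
have sy : 0 < sin (y / 2) by apply: sin_gt0_pi; apply/andP; split; lra.
have := cos_mulr2n (y / 2).
have -> : (y / 2) *+ 2 = y by lra.
rewrite cy => E.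
by have := cos2Dsin2 (y / 2); nra.
Qed.

Lemma cos_sin_eq x y : cos x = cos y -> sin x = sin y ->
  exists k : int, x = y + k%:~R * (pi *+ 2).
Proof.
move=> cxy sxy; have [|k kE] := @cos_eq1 (x - y).
  by rewrite cosB cxy sxy -!expr2 cos2Dsin2.
by exists k; rewrite -kE addrC subrK.
Qed.

Lemma unit_angle x y : x ^+ 2 + y ^+ 2 = 1 ->
  exists a, x = cos a /\ y = sin a.
Proof.
move=> xy1.
have x1 : -1 <= x <= 1.
  by have := sqr_ge0 y; have := sqr_ge0 x => *; apply/andP; split; nra.
have cx : cos (acos x) = x by apply: acosK; rewrite in_itv.
have sx : sin (acos x) = `|y|.
  by rewrite sin_acos// -xy1 addrAC subrr add0r sqrtr_sqr.
case: (leP 0 y) => y0.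
- by exists (acos x); rewrite cx sx ger0_norm.
- by exists (- acos x); rewrite cosN sinN cx sx ltr0_norm// opprK.
Qed.

(** The angle is the integral of the angular form (X dY - Y dX) / (X^2 + Y^2), started at an angle
    of the initial point. *)
Lemma angle_lift X Y dX dY :
  (forall t, is_derive t 1 X (dX t)) -> (forall t, is_derive t 1 Y (dY t)) ->
  continuous dX -> continuous dY -> (forall t, 0 < X t ^+ 2 + Y t ^+ 2) ->
  exists theta rho, forall t,
    [/\ is_derive t 1 theta
          ((X t * dY t - Y t * dX t) / (X t ^+ 2 + Y t ^+ 2)),
        0 < rho t, X t = rho t * cos (theta t) & Y t = rho t * sin (theta t)].
Proof.
move=> Xd Yd cdX cdY N0.
have cX : continuous X by move=> t; exact: is_derive_continuous (Xd t).
have cY : continuous Y by move=> t; exact: is_derive_continuous (Yd t).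
have cN : continuous (fun t => (X t ^+ 2 + Y t ^+ 2)^-1).
  apply: continuous_fV; first by apply: continuous_fD; exact: continuous_fX.
  by move=> t; rewrite gt_eqF.
have [th [_ thd]] := antiderivative (continuous_fM (continuous_fB
  (continuous_fM cX cdY) (continuous_fM cY cdX)) cN).
have [l [_ ld]] := antiderivative (continuous_fM (continuous_fD
  (continuous_fM cX cdX) (continuous_fM cY cdY)) cN).
pose r0 := Num.sqrt (X 0 ^+ 2 + Y 0 ^+ 2).
have r00 : 0 < r0 by rewrite sqrtr_gt0.
have r0E : r0 ^+ 2 = X 0 ^+ 2 + Y 0 ^+ 2 by rewrite sqr_sqrtr// ltW.
have [|a0 [a0c a0s]] := @unit_angle (X 0 / r0) (Y 0 / r0).
  by rewrite !expr_div_n -mulrDl -r0E divff// expf_neq0// gt_eqF.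
pose a t := th t - th 0 + a0.
have ad t : is_derive t 1 a
    ((X t * dY t - Y t * dX t) / (X t ^+ 2 + Y t ^+ 2)).
  rewrite -[X in is_derive _ _ _ X]addr0; apply: (is_derive_fD _ (is_derive_const _ _)).
  by rewrite -[X in is_derive _ _ _ X]subr0; apply: (is_derive_fB _ (is_derive_const _ _)).
(* Up to a sign for [B], these are the coordinates of the curve in the frame turned by [a] and
   rescaled by the logarithmic radius [l]. Both are constant, so the curve stays on the positive
   half-axis of that frame. *)
pose A t := (X t * cos (a t) + Y t * sin (a t)) * expR (- l t).
pose B t := (X t * sin (a t) - Y t * cos (a t)) * expR (- l t).
have ed t : is_derive t 1 (fun s => expR (- l s))
    (expR (- l t) * (- ((X t * dX t + Y t * dY t) / (X t ^+ 2 + Y t ^+ 2)))).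
  by apply: is_derive_fexp; exact: is_deriveN.
have Ad t : is_derive t 1 A 0.
  apply: (is_derive_ext (is_derive_fM
    (is_derive_fD (is_derive_fM (Xd t) (is_derive_fcos (ad t)))
      (is_derive_fM (Yd t) (is_derive_fsin (ad t)))) (ed t))) => //.
  by field; rewrite gt_eqF.
have Bd t : is_derive t 1 B 0.
  apply: (is_derive_ext (is_derive_fM
    (is_derive_fB (is_derive_fM (Xd t) (is_derive_fsin (ad t)))
      (is_derive_fM (Yd t) (is_derive_fcos (ad t)))) (ed t))) => //.
  by field; rewrite gt_eqF.
have aE : a 0 = a0 by rewrite /a subrr add0r.
have A0 t : 0 < X t * cos (a t) + Y t * sin (a t).
  have : 0 < A t.
    rewrite (derive0_const Ad t 0) /A aE -a0c -a0s pmulr_lgt0 ?expR_gt0//.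
    by rewrite !mulrA -mulrDl -!expr2 -r0E expr2 mulfK//; exact: lt0r_neq0.
  by rewrite /A pmulr_lgt0// expR_gt0.
have B0 t : X t * sin (a t) - Y t * cos (a t) = 0.
  apply/(mulIf (lt0r_neq0 (expR_gt0 (- l t)))); rewrite mul0r -/(B t).
  by rewrite (derive0_const Bd t 0) /B aE -a0c -a0s; field; exact: lt0r_neq0.
exists a, (fun t => X t * cos (a t) + Y t * sin (a t)) => t; split=> //.
- transitivity (X t * (cos (a t) ^+ 2 + sin (a t) ^+ 2)
    - (X t * sin (a t) - Y t * cos (a t)) * sin (a t)); last by ring.
  by rewrite B0 cos2Dsin2 mul0r subr0 mulr1.
- transitivity (Y t * (cos (a t) ^+ 2 + sin (a t) ^+ 2)
    + (X t * sin (a t) - Y t * cos (a t)) * cos (a t)); last by ring.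
  by rewrite B0 cos2Dsin2 mul0r addr0 mulr1.
Qed.

(** A continuous function that gains a full turn passes through a value with negative cosine.
    Applied to the difference of two angles, it shows that they turn equally often. *)
Lemma no_winding f s t (k : int) : continuous f -> (forall u, 0 <= cos (f u)) ->
  f t = f s + k%:~R * (pi *+ 2) -> k = 0.
Proof.
move=> cf cos0.
have pos (n : nat) u v : f u = f v + n.+1%:R * (pi *+ 2) -> False.
  move=> uv.
  (* Half a turn works if the cosine at [v] is positive. If it is 0, a quarter turn works for sine 1
     and three quarters for sine -1. *)
  have [d d0 dneg] : exists2 d, 0 <= d <= pi *+ 2 & cos (f v + d) < 0.
    have p0 : 0 < pi :> R := pi_gt0 _.
    have c := cos0 v; have cs := cos2Dsin2 (f v).
    case: (ltP 0 (cos (f v))) => c1.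
      by exists pi; [lra|rewrite cosDpi oppr_lt0].
    case: (ltP 0 (sin (f v))) => s1.
      by exists (pi / 2); [lra|rewrite cosDpihalf oppr_lt0].
    exists (pi + pi / 2); first by lra.
    by rewrite addrA cosDpihalf sinDpi opprK; nra.
  have [|w fw] := @IVT_unordered f v u (f v + d) cf.
    have n0 : 0 <= n%:R :> R by [].
    have p0 : 0 < pi :> R := pi_gt0 _.
    by rewrite uv -natr1; move: d0 => /andP[d0 d1]; apply/andP; split; nra.
  by have := cos0 w; rewrite fw leNgt dneg.
case: k => [[|n]|n] // E; exfalso.
- exact: (pos n t s).
- by apply: (pos n s t); rewrite E NegzE mulrNz mulNr subrK.
Qed.

Lemma polar_angle_unique (r r' x y : R) : 0 < r -> 0 < r' ->
  r * cos x = r' * cos y -> r * sin x = r' * sin y ->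
  exists k : int, x = y + k%:~R * (pi *+ 2).
Proof.
move=> r0 r'0 Ec Es.
have rr : r = r'.
  apply/eqP; rewrite -(eqrXn2 (_ : 0 < 2)%N) ?ltW//; apply/eqP.
  rewrite -[LHS]mulr1 -(cos2Dsin2 x) mulrDr -!exprMn Ec Es !exprMn -mulrDr.
  by rewrite cos2Dsin2 mulr1.
apply: cos_sin_eq; apply: (mulfI (lt0r_neq0 r0)).
- by rewrite Ec rr.
- by rewrite Es rr.
Qed.

(** The common consequence of closing up around the origin and of spiraling. The times [s] and [t]
    are not ordered, so both senses of rotation are covered. *)
Definition winds (x y : R -> R) := exists th s t,
  angle_along x y th /\ th s + pi *+ 2 <= th t.

Lemma all_angles f s t a : continuous f -> f s + pi *+ 2 <= f t ->
  exists v (k : int), f v = a + k%:~R * (pi *+ 2).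
Proof.
move=> cf st; have p0 : 0 < pi *+ 2 :> R by rewrite pmulrn_lgt0// pi_gt0.
have /andP[k1 k2] := floor_itv ((f t - a) / (pi *+ 2)).
set k := Num.floor _ in k1 k2.
have [|v fv] := @IVT_unordered f s t (a + k%:~R * (pi *+ 2)) cf.
  by move: k1 k2; rewrite intrD ler_pdivlMr// ltr_pdivrMr//; lra.
by exists v, k.
Qed.

Lemma winds_direction (x y : R -> R) a : winds x y ->
  exists v r, [/\ 0 < r, x v = r * cos a & y v = r * sin a].
Proof.
move=> [th [s [t [[cth polar] st]]]].
have [v [k vk]] := all_angles a cth st.
have [r [r0 xr yr]] := polar v; exists v, r; split=> //.
- have per u : cos (u + pi *+ 2) = cos u + 0 :> R by rewrite addr0 cosD2pi.
  by rewrite xr vk (quasi_periodic_int per) mulr0 addr0.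
- have per u : sin (u + pi *+ 2) = sin u + 0 :> R by rewrite addr0 sinD2pi.
  by rewrite yr vk (quasi_periodic_int per) mulr0 addr0.
Qed.

Lemma closed_winding (x y : R -> R) : closed_around_origin x y ->
  exists T th (k : int), [/\ x T = x 0, y T = y 0, angle_along x y th, k != 0 &
    th T = th 0 + k%:~R * (pi *+ 2)].
Proof.
move=> [T [th [T0 per _ [cth polar] thT]]].
have [xT yT] := per 0; rewrite add0r in xT yT.
have [r [r0 x0 y0]] := polar 0; have [r' [r'0 xr yr]] := polar T.
have [||k kE] := @polar_angle_unique r' r (th T) (th 0) r'0 r0.
- by rewrite -xr xT x0.
- by rewrite -yr yT y0.
exists T, th, k; split=> //.
by apply: contra_neq thT => k0; rewrite kE k0 mul0r addr0.
Qed.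

Lemma closed_winds (x y : R -> R) : closed_around_origin x y -> winds x y.
Proof.
move=> /closed_winding[T [th [k [_ _ ang k0 thT]]]].
have p0 : 0 < pi *+ 2 :> R by rewrite pmulrn_lgt0// pi_gt0.
case: (ltgtP k 0) k0 => // kn _.
- exists th, T, 0; split=> //.
  have k1 : k%:~R <= (-1)%:~R :> R by rewrite ler_int; lia.
  by rewrite mulrNz in k1; rewrite thT; nra.
- exists th, 0, T; split=> //.
  have k1 : 1%:~R <= k%:~R :> R by rewrite ler_int; lia.
  by rewrite thT; nra.
Qed.

Lemma spiral_winds (x y : R -> R) : spirals_to_origin x y -> winds x y.
Proof.
move=> [th [ang _ _ [/cvgryPge/(_ (th 0 + pi *+ 2))|/cvgrNyPle/(_ (th 0 - pi *+ 2))]]].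
- by move=> /filter_ex[t th0t]; exists th, 0, t.
- by move=> /filter_ex[t th0t]; exists th, t, 0; split=> //; lra.
Qed.

End Angles.

(** * Homogeneous forms without invariant lines: quasi-polar leaves and their growth *)

Section Monodromic.
Variables (R : realType) (m : nat) (p q : R -> R -> R).
Hypothesis p_hom : forall l x y : R, p (l * x) (l * y) = l ^+ m * p x y.
Hypothesis q_hom : forall l x y : R, q (l * x) (l * y) = l ^+ m * q x y.
Hypothesis p_cont : forall X Y : R -> R, continuous X -> continuous Y ->
  continuous (fun t => p (X t) (Y t)).
Hypothesis q_cont : forall X Y : R -> R, continuous X -> continuous Y ->
  continuous (fun t => q (X t) (Y t)).
Hypothesis monodromic : forall x y : R, 0 < x ^+ 2 + y ^+ 2 ->
  x * q x y - y * p x y != 0.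
Implicit Types (g X Y dX dY th : R -> R) (s t : R) (a b : nat).

(* In the quasi-polar coordinates x = l^a cos t, y = l^b sin t, the leaves of
   the pull-back of p dy - q dx under (x^b, y^a) satisfy
   dl / dt = l * growth_rate a b t. *)
Definition growth_rate a b t : R :=
  (a%:R * sin t ^+ a.-1 * p (cos t ^+ b) (sin t ^+ a) * cos t
   + b%:R * cos t ^+ b.-1 * q (cos t ^+ b) (sin t ^+ a) * sin t)
  / (a%:R * b%:R * (cos t ^+ b * q (cos t ^+ b) (sin t ^+ a)
                    - sin t ^+ a * p (cos t ^+ b) (sin t ^+ a))).

Lemma sumr_sqr_gt0 (x y : R) : (x != 0) || (y != 0) -> 0 < x ^+ 2 + y ^+ 2.
Proof.
move=> xy; rewrite lt0r addr_ge0 ?sqr_ge0// andbT.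
by rewrite paddr_eq0 ?sqr_ge0// !sqrf_eq0 negb_and.
Qed.

Lemma cos_sin_neq0 t : (cos t != 0) || (sin t != 0).
Proof.
have := cos2Dsin2 t; case: eqP => // ->; case: eqP => // ->.
by rewrite expr0n addr0 => /eqP; rewrite eq_sym oner_eq0.
Qed.

Lemma growth_rate_den_neq0 a b t : (0 < a)%N -> (0 < b)%N ->
  a%:R * b%:R * (cos t ^+ b * q (cos t ^+ b) (sin t ^+ a)
                    - sin t ^+ a * p (cos t ^+ b) (sin t ^+ a)) != 0.
Proof.
move=> a0 b0; rewrite !mulf_neq0 ?pnatr_eq0 -?lt0n//.
apply: monodromic; apply: sumr_sqr_gt0.
by rewrite !expf_eq0 a0 b0/= cos_sin_neq0.
Qed.

Lemma continuous_growth_rate a b : (0 < a)%N -> (0 < b)%N ->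
  continuous (growth_rate a b).
Proof.
move=> a0 b0.
have cc : continuous (fun t => cos t ^+ b : R).
  exact: continuous_fX (@continuous_cos R).
have cs : continuous (fun t => sin t ^+ a : R).
  exact: continuous_fX (@continuous_sin R).
have ck (c : R) : continuous (fun _ : R => c) by move=> t; exact: cvg_cst.
have cp := p_cont cc cs; have cq := q_cont cc cs.
apply: continuous_fM.
  apply: continuous_fD.
    apply: continuous_fM (@continuous_cos R).
    by apply: continuous_fM cp; apply: continuous_fM (ck _) _;
      exact: continuous_fX (@continuous_sin R).
  apply: continuous_fM (@continuous_sin R).
  by apply: continuous_fM cq; apply: continuous_fM (ck _) _;
    exact: continuous_fX (@continuous_cos R).
apply: continuous_fV; last by move=> t; exact: growth_rate_den_neq0.
by apply: continuous_fM (ck _) _; apply: continuous_fB; exact: continuous_fM.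
Qed.

Definition growth_potential a b g (J : R) :=
  (forall t, is_derive t 1 g (growth_rate a b t)) /\
  (forall t, g (t + pi *+ 2) = g t + J).

(** The rate is periodic, so g (t + 2 pi) - g t has derivative 0; its value at 0 serves as [J]. *)
Lemma growth_potential_exists a b : (0 < a)%N -> (0 < b)%N ->
  exists g J, growth_potential a b g J.
Proof.
move=> a0 b0; have [g [_ gd]] := antiderivative (continuous_growth_rate a0 b0).
exists g, (g (0 + pi *+ 2) - g 0); split=> // t.
have d (u : R) : is_derive u 1 (fun u => g (u + pi *+ 2) - g u) 0.
  apply: (is_derive_ext (is_derive_fB (is_derive_fcomp
    (is_derive_fD (is_derive_ident u) (is_derive_const (pi *+ 2) u)) (gd _)) (gd u))) => //.
  by rewrite /growth_rate sinD2pi cosD2pi addr0 mulr1 subrr.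
by have /= -> := derive0_const d 0 t; rewrite [RHS]addrC subrK.
Qed.

(** With unit weights the rate is (x p + y q) / (x q - y p). Numerator and denominator have the same
    degree, so the formula passes from the unit circle to every radius. *)
Lemma growth_rate11 t (r : R) : 0 < r ->
  growth_rate 1 1 t * ((r * cos t) * q (r * cos t) (r * sin t)
                       - (r * sin t) * p (r * cos t) (r * sin t))
  = (r * cos t) * p (r * cos t) (r * sin t)
    + (r * sin t) * q (r * cos t) (r * sin t).
Proof.
move=> r0; rewrite /growth_rate !expr1 !expr0 !p_hom !q_hom.
have := growth_rate_den_neq0 t (ltn0Sn 0) (ltn0Sn 0).
rewrite !expr1 !mul1r => d0; field.
exact: d0.
Qed.

(* log (X^2 + Y^2) - 2 g(angle) is constant along the curve. The comparison angle
   th stays within pi / 2 of the angle of (X, Y), so both turn k times. *)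
Lemma radial_growth g J X Y dX dY th s t (k : int) (u : R) :
  growth_potential 1 1 g J ->
  (forall t, is_derive t 1 X (dX t)) -> (forall t, is_derive t 1 Y (dY t)) ->
  continuous dX -> continuous dY -> (forall t, 0 < X t ^+ 2 + Y t ^+ 2) ->
  (forall t, p (X t) (Y t) * dY t = q (X t) (Y t) * dX t) ->
  continuous th -> (forall t, 0 <= X t * cos (th t) + Y t * sin (th t)) ->
  0 < u -> X t = u * X s -> Y t = u * Y s -> th t = th s + k%:~R * (pi *+ 2) ->
  u ^+ 2 = expR (2 * k%:~R * J).
Proof.
move=> [gd gJ] Xd Yd cdX cdY N0 tang cth same u0 Xt Yt tht.
have [al [rho lift]] := angle_lift Xd Yd cdX cdY N0.
have Nrho (v : R) : X v ^+ 2 + Y v ^+ 2 = rho v ^+ 2.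
  have [_ _ -> ->] := lift v.
  by rewrite !exprMn -mulrDr cos2Dsin2 mulr1.
pose E v := (X v ^+ 2 + Y v ^+ 2) * expR (- 2 * g (al v)).
have Ed (v : R) : is_derive v 1 E 0.
  have [ald r0 Xv Yv] := lift v.
  apply: (is_derive_ext (is_derive_fM
    (is_derive_fD (is_derive_fX 2 (Xd v)) (is_derive_fX 2 (Yd v)))
    (is_derive_fexp (is_derive_fM (is_derive_const (- 2) v)
      (is_derive_fcomp ald (gd (al v))))))) => //.
  have := growth_rate11 (al v) r0; rewrite -Xv -Yv.
  set h := growth_rate 1 1 _ => hE.
  have d0 := monodromic (N0 v).
  (* The law d(log rho) = h d(angle) in Cartesian form. After multiplication by x q - y p, the
     difference of the two sides is (X^2 + Y^2)(q dX - p dY), which tangency kills. *)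
  have radial : X v * dX v + Y v * dY v = h * (X v * dY v - Y v * dX v).
    apply: (mulfI d0); rewrite mulrA [_ * h]mulrC hE.
    apply/eqP; rewrite -subr_eq0.
    rewrite (_ : _ - _ = (X v ^+ 2 + Y v ^+ 2) *
      (q (X v) (Y v) * dX v - p (X v) (Y v) * dY v)); last by ring.
    by rewrite tang subrr mulr0.
  set e := expR _.
  transitivity (2 * (X v * dX v + Y v * dY v - h * (X v * dY v - Y v * dX v)) * e);
    first by rewrite radial subrr mulr0 mul0r.
  by field; rewrite gt_eqF.
have Nt : X t ^+ 2 + Y t ^+ 2 = u ^+ 2 * (X s ^+ 2 + Y s ^+ 2).
  by rewrite Xt Yt !exprMn -mulrDr.
have [_ rt Xrt Yrt] := lift t; have [_ rs Xrs Yrs] := lift s.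
have [|||j alt] := @polar_angle_unique _ (rho t) (u * rho s) (al t) (al s) rt.
- exact: mulr_gt0.
- by rewrite -mulrA -Xrs -Xrt Xt.
- by rewrite -mulrA -Yrs -Yrt Yt.
have jk : j = k.
  apply/eqP; rewrite -subr_eq0; apply/eqP.
  apply: (@no_winding _ (fun v => al v - th v) s t).
  - apply: continuous_fB => // v; have [ald _ _ _] := lift v.
    exact: is_derive_continuous ald.
  - move=> v; rewrite cosB; have [_ r0 Xv Yv] := lift v.
    have := same v; rewrite Xv Yv -!mulrA -mulrDr.
    by rewrite pmulr_rge0.
  - by rewrite alt tht intrB; ring.
have := derive0_const Ed t s; rewrite /E Nt alt jk (quasi_periodic_int gJ).
move=> E1.
have Ns := N0 s.
have : u ^+ 2 * expR (- 2 * (g (al s) + k%:~R * J)) = expR (- 2 * g (al s)).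
  by apply: (mulfI (lt0r_neq0 Ns)); rewrite -E1; ring.
move/(congr1 (fun z => z * expR (2 * (g (al s) + k%:~R * J)))).
rewrite -mulrA -!expRD => E2.
transitivity (u ^+ 2 * expR 0); first by rewrite expR0 mulr1.
transitivity (u ^+ 2 *
  expR (- 2 * (g (al s) + k%:~R * J) + 2 * (g (al s) + k%:~R * J))).
  by congr (_ * expR _); ring.
by rewrite E2; congr expR; ring.
Qed.

(** The constant [c] selects the leaf: increasing it by d applies the dilation (x, y) |-> (l^a x,
    l^b y) with l = exp d. *)
Definition qp_x a g (c : R) t : R := expR (g t + c) ^+ a * cos t.
Definition qp_y b g (c : R) t : R := expR (g t + c) ^+ b * sin t.
Definition qp_dx a b g c t : R :=
  expR (g t + c) ^+ a * (a%:R * growth_rate a b t * cos t - sin t).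
Definition qp_dy a b g c t : R :=
  expR (g t + c) ^+ b * (b%:R * growth_rate a b t * sin t + cos t).

Section QuasiPolarCurve.
Variables (a b : nat) (g : R -> R) (J c : R).
Hypotheses (a_gt0 : (0 < a)%N) (b_gt0 : (0 < b)%N).
Hypothesis g_pot : growth_potential a b g J.

Lemma is_derive_exp_potential n t :
  is_derive t 1 (fun t => expR (g t + c) ^+ n)
    (n%:R * growth_rate a b t * expR (g t + c) ^+ n).
Proof.
apply: (is_derive_ext (is_derive_fX n (is_derive_fexp
  (is_derive_fD (g_pot.1 t) (is_derive_const c t))))) => //.
case: n => [|n]; first by rewrite !mul0r.
by rewrite exprS /=; ring.
Qed.

Lemma is_derive_qp_x t : is_derive t 1 (qp_x a g c) (qp_dx a b g c t).
Proof.
apply: (is_derive_ext (is_derive_fM (is_derive_exp_potential a t)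
  (is_derive_fcos (is_derive_ident t)))) => //.
by rewrite /qp_dx; ring.
Qed.

Lemma is_derive_qp_y t : is_derive t 1 (qp_y b g c) (qp_dy a b g c t).
Proof.
apply: (is_derive_ext (is_derive_fM (is_derive_exp_potential b t)
  (is_derive_fsin (is_derive_ident t)))) => //.
by rewrite /qp_dy; ring.
Qed.

Lemma continuous_exp_potential n : continuous (fun t => expR (g t + c) ^+ n).
Proof. by move=> t; exact: is_derive_continuous (is_derive_exp_potential n t). Qed.

Lemma continuous_qp_dx : continuous (qp_dx a b g c).
Proof.
have cg := continuous_growth_rate a_gt0 b_gt0.
have ck (k : R) : continuous (fun _ : R => k) by move=> t; exact: cvg_cst.
unfold qp_dx; apply: continuous_fM (@continuous_exp_potential a) _.
apply: continuous_fB (@continuous_sin R).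
by apply: continuous_fM (@continuous_cos R); exact: continuous_fM (ck _) cg.
Qed.

Lemma continuous_qp_dy : continuous (qp_dy a b g c).
Proof.
have cg := continuous_growth_rate a_gt0 b_gt0.
have ck (k : R) : continuous (fun _ : R => k) by move=> t; exact: cvg_cst.
unfold qp_dy; apply: continuous_fM (@continuous_exp_potential b) _.
apply: continuous_fD (@continuous_cos R).
by apply: continuous_fM (@continuous_sin R); exact: continuous_fM (ck _) cg.
Qed.

Lemma qp_neq0 t : 0 < qp_x a g c t ^+ 2 + qp_y b g c t ^+ 2.
Proof.
apply: sumr_sqr_gt0; rewrite /qp_x /qp_y !mulf_eq0.
by rewrite !(gt_eqF (exprn_gt0 _ (expR_gt0 _))) cos_sin_neq0.
Qed.

(** Eliminating the growth rate from two vanishing derivatives leaves a cos^2 + b sin^2 = 0,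
    impossible for positive weights. *)
Lemma qp_regular t : (qp_dx a b g c t != 0) || (qp_dy a b g c t != 0).
Proof.
rewrite -negb_and; apply/negP => /andP[].
rewrite !mulf_eq0 !(gt_eqF (exprn_gt0 _ (expR_gt0 _))) /=.
move=> /eqP E1 /eqP E2.
have : b%:R * sin t ^+ 2 + a%:R * cos t ^+ 2 = 0.
  transitivity (a%:R * cos t * (b%:R * growth_rate a b t * sin t + cos t)
     - b%:R * sin t * (a%:R * growth_rate a b t * cos t - sin t)); first by ring.
  by rewrite E1 E2 !mulr0 subrr.
have a1 : 1 <= a%:R :> R by rewrite ler1n.
have b1 : 1 <= b%:R :> R by rewrite ler1n.
have c2 := sqr_ge0 (cos t); have s2 := sqr_ge0 (sin t).
by have := cos2Dsin2 t; nra.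
Qed.

(** By quasi-homogeneity the same power of l factors out of both sides. What remains is the equation
    at l = 1, that is, the definition of [growth_rate] with its denominator cleared. *)
Lemma qp_tangent t :
  a%:R * qp_y b g c t ^+ a.-1 * p (qp_x a g c t ^+ b) (qp_y b g c t ^+ a)
    * qp_dy a b g c t
  = b%:R * qp_x a g c t ^+ b.-1 * q (qp_x a g c t ^+ b) (qp_y b g c t ^+ a)
    * qp_dx a b g c t.
Proof.
rewrite /qp_x /qp_y /qp_dx /qp_dy; set l := expR _; set h := growth_rate a b t.
have den := growth_rate_den_neq0 t a_gt0 b_gt0.
have hE : h * _ = _ := divfK den _.
move: hE.
set C := cos t; set S := sin t.
have -> : (l ^+ b * S) ^+ a = l ^+ (a * b) * S ^+ a.
  by rewrite exprMn -exprM mulnC.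
rewrite [(l ^+ a * C) ^+ b]exprMn -exprM p_hom q_hom.
set p0 := p _ _; set q0 := q _ _; set L := (l ^+ (a * b)) ^+ m.
move=> hE.
have la : (l ^+ b * S) ^+ a.-1 * l ^+ b = l ^+ (a * b) * S ^+ a.-1.
  rewrite exprMn mulrAC -exprSr prednK//.
  by rewrite -exprM mulnC.
have lb : (l ^+ a * C) ^+ b.-1 * l ^+ a = l ^+ (a * b) * C ^+ b.-1.
  by rewrite exprMn mulrAC -exprSr prednK// -exprM.
transitivity (l ^+ (a * b) * L *
   (a%:R * S ^+ a.-1 * p0 * (b%:R * h * S + C))).
  by move: la; set u := (_ * S) ^+ _; set v := l ^+ b; set w := l ^+ (a * b) => la;
    transitivity (u * v * L * (a%:R * p0 * (b%:R * h * S + C)));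
      [ring|rewrite la; ring].
transitivity (l ^+ (a * b) * L *
   (b%:R * C ^+ b.-1 * q0 * (a%:R * h * C - S))); last first.
  by move: lb; set u := (_ * C) ^+ _; set v := l ^+ a; set w := l ^+ (a * b) => lb;
    transitivity (u * v * L * (b%:R * q0 * (a%:R * h * C - S)));
      [rewrite lb; ring|ring].
congr (_ * _); apply/eqP; rewrite -subr_eq0.
have Sa : S ^+ a = S * S ^+ a.-1 by rewrite -exprS prednK.
have Cb : C ^+ b = C * C ^+ b.-1 by rewrite -exprS prednK.
move: hE; rewrite {1}Cb {1}Sa => /eqP; rewrite -subr_eq0 => /eqP hE.
rewrite -oppr_eq0 -hE; apply/eqP; ring.
Qed.

(** The coordinates are positive multiples of cos t and sin t, so the point stays in the closed
    quadrant of the direction t. *)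
Lemma qp_angle : exists theta rho, [/\ continuous theta,
  forall t, [/\ 0 < rho t, qp_x a g c t = rho t * cos (theta t)
    & qp_y b g c t = rho t * sin (theta t)] &
  forall t, 0 <= cos (theta t - t)].
Proof.
have [th [rho H]] := angle_lift is_derive_qp_x is_derive_qp_y
  continuous_qp_dx continuous_qp_dy qp_neq0.
exists th, rho; split.
- by move=> t; have [d _ _ _] := H t; exact: is_derive_continuous d.
- by move=> t; have [] := H t.
- move=> t; have [_ r0 xE yE] := H t.
  rewrite -(pmulr_rge0 _ r0) cosB mulrDr !mulrA -xE -yE /qp_x /qp_y.
  rewrite -!mulrA -!expr2 addr_ge0// mulr_ge0 ?sqr_ge0//.
  all: by rewrite exprn_ge0// expR_ge0.
Qed.

Lemma qp_periodic t : J = 0 ->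
  qp_x a g c (t + pi *+ 2) = qp_x a g c t /\
  qp_y b g c (t + pi *+ 2) = qp_y b g c t.
Proof. by move=> J0; rewrite /qp_x /qp_y g_pot.2 J0 addr0 cosD2pi sinD2pi. Qed.

(** Each orbit of the dilations meets the unit circle once. If one scale were smaller, cos^2 and
    sin^2 would both be no larger at the other angle; as each pair sums to 1 they would agree, which
    forces cos = sin = 0. *)
Lemma qp_inj s t : qp_x a g c s = qp_x a g c t -> qp_y b g c s = qp_y b g c t ->
  cos s = cos t /\ sin s = sin t.
Proof.
rewrite /qp_x /qp_y; set l := expR _; set l' := expR _ => X Y.
have l0 : 0 < l := expR_gt0 _; have l'0 : 0 < l' := expR_gt0 _.
suff ll : l = l'.
  rewrite ll in X Y; split.
  - by apply: (mulfI _ X); rewrite gt_eqF// exprn_gt0.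
  - by apply: (mulfI _ Y); rewrite gt_eqF// exprn_gt0.
have lt_false v w (x y : R) : 0 < v -> v < w ->
    v ^+ a * cos x = w ^+ a * cos y -> v ^+ b * sin x = w ^+ b * sin y -> False.
  move=> v0 vw Ex Ey.
  have step n z z' : (0 < n)%N -> v ^+ n * z = w ^+ n * z' ->
      z' ^+ 2 <= z ^+ 2 /\ (z' ^+ 2 = z ^+ 2 -> z = 0).
    move=> n0 E.
    have vwn : v ^+ n < w ^+ n by rewrite ltrXn2r ?ltW// -lt0n.
    have vn : 0 < v ^+ n by rewrite exprn_gt0.
    have E2 : (v ^+ n) ^+ 2 * z ^+ 2 = (w ^+ n) ^+ 2 * z' ^+ 2.
      by rewrite -!exprMn E.
    have lt2 : (v ^+ n) ^+ 2 < (w ^+ n) ^+ 2 by rewrite ltrXn2r// ltW.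
    have v2 : 0 < (v ^+ n) ^+ 2 by rewrite exprn_gt0.
    have z2 := sqr_ge0 z; have z'2 := sqr_ge0 z'.
    split; first by nra.
    by move=> zz; apply/eqP; rewrite -sqrf_eq0; apply/eqP; nra.
  have [c1 c2] := step _ _ _ a_gt0 Ex; have [s1 s2] := step _ _ _ b_gt0 Ey.
  have [zc zs] : cos y ^+ 2 = cos x ^+ 2 /\ sin y ^+ 2 = sin x ^+ 2.
    have := cos2Dsin2 x; have := cos2Dsin2 y; move: c1 s1; clear Ex Ey c2 s2 step X Y.
    by move: (cos x ^+ 2) (cos y ^+ 2) (sin x ^+ 2) (sin y ^+ 2) => *; split; lra.
  by have := cos_sin_neq0 x; rewrite (c2 zc) (s2 zs) eqxx.
case: (ltgtP l l') => // ll; exfalso.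
- exact: (lt_false _ _ _ _ l0 ll X Y).
- exact: (lt_false _ _ _ _ l'0 ll (esym X) (esym Y)).
Qed.

Lemma qp_closed : J = 0 -> closed_around_origin (qp_x a g c) (qp_y b g c).
Proof.
move=> J0; have p0 : 0 < pi :> R := pi_gt0 _.
have [th [rho [cth polar near_id]]] := qp_angle.
exists (pi *+ 2), th; split.
- by lra.
- by move=> t; exact: qp_periodic.
- move=> s t; rewrite !in_itv/= => /andP[s0 s1] /andP[t0 t1] [X Y].
  have [cst sst] := qp_inj X Y.
  have [k kE] := cos_sin_eq cst sst.
  have k0 : k = 0.
    have up : k%:~R < (1%:~R : R) by rewrite -(@ltr_pM2r _ (pi *+ 2)); lra.
    have lo : ((-1)%:~R : R) < k%:~R.
      by rewrite -(@ltr_pM2r _ (pi *+ 2)) ?mulrNz; lra.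
    by move: up lo; rewrite !ltr_int; lia.
  by rewrite kE k0 mul0r addr0.
- by split=> // t; exists (rho t); exact: polar.
- have [r0 x0 y0] := polar 0; have [r1 x1 y1] := polar (0 + pi *+ 2).
  have [xp yp] := qp_periodic 0 J0.
  have [||k kE] := polar_angle_unique r1 r0 (x := th (0 + pi *+ 2)) (y := th 0).
  - by rewrite -x1 xp x0.
  - by rewrite -y1 yp y0.
  (* The angle follows the parameter t by [qp_angle], so it makes exactly one turn, as t does. *)
  have k1 : k - 1 = 0.
    apply: (@no_winding _ (fun t => th t - t) 0 (0 + pi *+ 2)) => //.
    - by apply: continuous_fB => // t; exact: cvg_id.
    - by rewrite kE intrB; ring.
  rewrite -[X in th X]add0r kE; move/eqP: k1; rewrite subr_eq0 => /eqP ->.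
  by rewrite mul1r; apply/eqP; lra.
Qed.

End QuasiPolarCurve.

(** The point is dilated onto the unit circle; the angle reached there is the parameter t, and [c]
    undoes the dilation. *)
Lemma qp_through a b g (x y : R) : (0 < a)%N -> (0 < b)%N ->
  0 < x ^+ 2 + y ^+ 2 -> exists c t, qp_x a g c t = x /\ qp_y b g c t = y.
Proof.
move=> a0 b0 xy0.
pose f l := (x * l ^+ a) ^+ 2 + (y * l ^+ b) ^+ 2.
have cf : continuous f.
  have ck (k : R) : continuous (fun _ : R => k) by move=> t; exact: cvg_cst.
  have ci : continuous (fun l : R => l) by move=> t; exact: cvg_id.
  by apply: continuous_fD; apply: continuous_fX; apply: continuous_fM (ck _) _;
    exact: continuous_fX.
(* Since M >= 1, f M >= (x^2 + y^2) M = x^2 + y^2 + 1. *)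
pose M := 1 + (x ^+ 2 + y ^+ 2)^-1.
have M1 : 1 <= M by rewrite lerDl invr_ge0 ltW.
have fM : 1 <= f M.
  have Mn n : (0 < n)%N -> M <= (M ^+ n) ^+ 2.
    by move=> n0; rewrite -exprM ler_eXnr// muln_gt0 n0.
  have : (x ^+ 2 + y ^+ 2) * M <= f M.
    by rewrite /f mulrDl !exprMn lerD// ler_wpM2l ?sqr_ge0// Mn.
  apply: le_trans; rewrite /M mulrDr mulr1 divff ?gt_eqF//.
  by rewrite lerDr ltW.
have [|l fl] := @IVT_unordered _ f 0 M 1 cf.
  by rewrite fM /f !expr0n !gtn_eqF//= !mulr0 expr0n addr0 ler01.
have [l0|l0] := eqVneq l 0.
  by move: fl; rewrite /f l0 !expr0n !gtn_eqF//= !mulr0 expr0n addr0 => /eqP;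
    rewrite eq_sym oner_eq0.
(* The intermediate value theorem does not give the sign of [l], but [f] is even, so |l| is a root
   as well. *)
have nl0 : 0 < `|l| by rewrite normr_gt0.
have f_abs : f `|l| = 1.
  by rewrite -fl /f !exprMn -!exprM ![(_ * 2)%N]mulnC !exprM real_normK// num_real.
have [t [tc ts]] := unit_angle f_abs.
exists (- ln `|l| - g t), t; rewrite /qp_x /qp_y -tc -ts [g t + _]addrC subrK.
rewrite expRN lnK ?posrE//.
by split; rewrite mulrCA exprVn mulVf ?mulr1// expf_neq0// gt_eqF.
Qed.
Implicit Types (x y dx dy : R -> R).

(** The conservation law applied to the push-forward (x^b, y^a), whose velocity may vanish on the
    axes. *)
Lemma pullback_growth a b g J x y dx dy th s t (k : int) (u : R) :
  (0 < a)%N -> (0 < b)%N -> growth_potential 1 1 g J ->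
  (forall t, is_derive t 1 x (dx t)) -> (forall t, is_derive t 1 y (dy t)) ->
  continuous dx -> continuous dy -> (forall t, 0 < x t ^+ 2 + y t ^+ 2) ->
  (forall t, a%:R * y t ^+ a.-1 * p (x t ^+ b) (y t ^+ a) * dy t
             = b%:R * x t ^+ b.-1 * q (x t ^+ b) (y t ^+ a) * dx t) ->
  continuous th ->
  (forall t, 0 <= x t ^+ b * cos (th t) + y t ^+ a * sin (th t)) ->
  0 < u -> x t ^+ b = u * x s ^+ b -> y t ^+ a = u * y s ^+ a ->
  th t = th s + k%:~R * (pi *+ 2) ->
  u ^+ 2 = expR (2 * k%:~R * J).
Proof.
move=> a0 b0 gJ xd yd cdx cdy xy0 tang cth same u0 xt yt tht.
have cx : continuous x by move=> v; exact: is_derive_continuous (xd v).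
have cy : continuous y by move=> v; exact: is_derive_continuous (yd v).
have ck (r : R) : continuous (fun _ : R => r) by move=> v; exact: cvg_cst.
apply: (@radial_growth g J (fun t => x t ^+ b) (fun t => y t ^+ a)
  (fun t => b%:R * x t ^+ b.-1 * dx t) (fun t => a%:R * y t ^+ a.-1 * dy t)
  th s t k u) => //.
- by move=> v; exact: is_derive_fX.
- by move=> v; exact: is_derive_fX.
- apply: continuous_fM => //; apply: continuous_fM (ck _) _.
  exact: continuous_fX.
- apply: continuous_fM => //; apply: continuous_fM (ck _) _.
  exact: continuous_fX.
- move=> v; apply: sumr_sqr_gt0; rewrite !expf_eq0 a0 b0 /=.
  have := xy0 v; case: eqP => // ->; case: eqP => // ->.
  by rewrite expr0n addr0 ltxx.
- by move=> v; rewrite mulrCA [RHS]mulrCA mulrA [RHS]mulrA; have := tang v;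
    rewrite -!mulrA ![_ * (p _ _ * _)]mulrCA ![_ * (q _ _ * _)]mulrCA !mulrA.
Qed.

(** Both coordinates of the pushed-forward leaf carry the positive factor exp (g t)^(a b), so a
    comparison angle for (cos^b, sin^a) serves for the leaf too. One period of t multiplies the leaf
    by exp(J)^(a b) while that angle makes k turns. *)
Lemma growth_degree a b g J g1 J1 th (k : int) :
  (0 < a)%N -> (0 < b)%N ->
  growth_potential a b g J -> growth_potential 1 1 g1 J1 -> continuous th ->
  (forall t, 0 <= cos t ^+ b * cos (th t) + sin t ^+ a * sin (th t)) ->
  th (0 + pi *+ 2) = th 0 + k%:~R * (pi *+ 2) ->
  (a * b)%:R * J = k%:~R * J1.
Proof.
move=> a0 b0 gJ gJ1 cth same thk.
have xE t : qp_x a g 0 t ^+ b = expR (g t) ^+ (a * b) * cos t ^+ b.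
  by rewrite /qp_x addr0 exprMn -exprM.
have yE t : qp_y b g 0 t ^+ a = expR (g t) ^+ (a * b) * sin t ^+ a.
  by rewrite /qp_y addr0 exprMn -exprM mulnC.
have E : (expR J ^+ (a * b)) ^+ 2 = expR (2 * k%:~R * J1).
  apply: (@pullback_growth a b g1 J1 (qp_x a g 0) (qp_y b g 0) (qp_dx a b g 0)
    (qp_dy a b g 0) th 0 (0 + pi *+ 2) k (expR J ^+ (a * b)) a0 b0 gJ1
    (is_derive_qp_x 0 gJ) (is_derive_qp_y 0 gJ) (continuous_qp_dx (c := 0) a0 b0 gJ)
    (continuous_qp_dy (c := 0) a0 b0 gJ) (qp_neq0 a b g 0) (qp_tangent g 0 a0 b0) cth).
  - by move=> t; rewrite xE yE -!mulrA -mulrDr mulr_ge0// exprn_ge0// expR_ge0.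
  - by rewrite exprn_gt0// expR_gt0.
  - by rewrite !xE gJ.2 cosD2pi expRD exprMn; ring.
  - by rewrite !yE gJ.2 sinD2pi expRD exprMn; ring.
  - exact: thk.
have : expR (2 * ((a * b)%:R * J)) = expR (2 * (k%:~R * J1)).
  rewrite [in RHS]mulrA -E -exprM -expRM_natl; congr expR.
  by rewrite [in RHS]natrM; ring.
by move/expR_inj; apply: mulfI; rewrite pnatr_eq0.
Qed.

Lemma growth_odd a b g J g1 J1 : odd a -> odd b ->
  growth_potential a b g J -> growth_potential 1 1 g1 J1 ->
  (J = 0) <-> (J1 = 0).
Proof.
move=> oa ob gJ gJ1.
have a0 := odd_gt0 oa; have b0 := odd_gt0 ob.
have E : (a * b)%:R * J = 1%:~R * J1.
  (* For odd weights the scalar product with the direction t is cos^(b+1) + sin^(a+1), a sum of even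
     powers. *)
  apply: (growth_degree (th := fun t => t) a0 b0 gJ gJ1).
  - by move=> t; exact: cvg_id.
  - move=> t; rewrite -!exprSr addr_ge0// exprn_even_ge0//= ?oa ?ob//.
  - by rewrite mul1r.
rewrite mul1r in E; split=> [J0|J10]; first by rewrite -E J0 mulr0.
apply/eqP; have /eqP := E; rewrite J10 mulf_eq0 pnatr_eq0 muln_eq0.
by rewrite !gtn_eqF.
Qed.

Lemma growth_even a b g J : (0 < a)%N -> (0 < b)%N -> odd a (+) odd b ->
  growth_potential a b g J -> J = 0.
Proof.
move=> a0 b0 ab gJ.
have [g1 [J1 gJ1]] := growth_potential_exists (ltn0Sn 0) (ltn0Sn 0).
have E : (a * b)%:R * J = 0%:~R * J1.
  have ck (r : R) : continuous (fun _ : R => r) by move=> v; exact: cvg_cst.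
  (* The even power fixes the half-plane: the upper one (angle pi / 2) if a is even, the right one
     (angle 0) if b is even. *)
  case: (boolP (odd b)) => ob.
  - apply: (growth_degree (th := fun=> pi / 2) a0 b0 gJ gJ1) => //.
    + move=> t; rewrite cos_pihalf sin_pihalf mulr0 add0r mulr1.
      by rewrite exprn_even_ge0//; move: ab; rewrite ob addbT.
    + by rewrite mul0r addr0.
  - apply: (growth_degree (th := fun=> 0) a0 b0 gJ gJ1) => //.
    + move=> t; rewrite cos0 sin0 mulr0 addr0 mulr1.
      by rewrite exprn_even_ge0.
    + by rewrite mul0r addr0.
rewrite mul0r in E.
apply/eqP; have /eqP := E; rewrite mulf_eq0 pnatr_eq0 muln_eq0.
by rewrite !gtn_eqF.
Qed.

(** Odd powers keep signs, so the angle of a closed leaf of the pull-back is a comparison angle for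
    its push-forward. Closing up means u = 1, whence 2 k J = 0 with k non-zero; here [J] belongs to
    the homogeneous form. *)
Lemma closed_growth a b g J x y dx dy : odd a -> odd b ->
  growth_potential 1 1 g J ->
  (forall t, is_derive t 1 x (dx t)) -> (forall t, is_derive t 1 y (dy t)) ->
  continuous dx -> continuous dy -> (forall t, 0 < x t ^+ 2 + y t ^+ 2) ->
  (forall t, a%:R * y t ^+ a.-1 * p (x t ^+ b) (y t ^+ a) * dy t
             = b%:R * x t ^+ b.-1 * q (x t ^+ b) (y t ^+ a) * dx t) ->
  closed_around_origin x y -> J = 0.
Proof.
move=> oa ob gJ xd yd cdx cdy xy0 tang.
move=> /closed_winding[T [th [k [xT yT [cth polar] k0 kE]]]].
have a0 := odd_gt0 oa; have b0 := odd_gt0 ob.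
have same t : 0 <= x t ^+ b * cos (th t) + y t ^+ a * sin (th t).
  have [r [r0 -> ->]] := polar t.
  have c0 : 0 <= cos (th t) ^+ b.+1 by rewrite exprn_even_ge0//= ob.
  have s0 : 0 <= sin (th t) ^+ a.+1 by rewrite exprn_even_ge0//= oa.
  by rewrite !exprMn -!mulrA -!exprSr addr_ge0// mulr_ge0// exprn_ge0// ltW.
have := @pullback_growth a b g J x y dx dy th 0 T k 1 a0 b0 gJ xd yd cdx cdy
  xy0 tang cth same ltr01.
rewrite xT yT !mul1r expr1n => /(_ erefl erefl kE) E.
have : expR (2 * k%:~R * J) = expR 0 by rewrite expR0 -E.
move/expR_inj => /eqP; rewrite !mulf_eq0 pnatr_eq0 /= intr_eq0.
by rewrite (negPf k0) => /eqP.
Qed.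

(** Without its mean slope the potential is continuous and periodic, hence bounded. *)
Lemma potential_bound a b g J : growth_potential a b g J ->
  exists M, forall t, g t - J / (pi *+ 2) * t <= M.
Proof.
move=> [gd gJ]; have p0 : 0 < pi *+ 2 :> R by rewrite pmulrn_lgt0// pi_gt0.
pose f t := g t - J / (pi *+ 2) * t.
have cf : continuous f.
  apply: continuous_fB; first by move=> t; exact: is_derive_continuous (gd t).
  by apply: continuous_fM => t; [exact: cvg_cst|exact: cvg_id].
have fp t : f (t + pi *+ 2) = f t + 0.
  by rewrite /f gJ mulrDr divfK ?gt_eqF// opprD addrACA subrr.
have [M _ fM] := EVT_max (ltW p0) (continuous_subspaceT cf).
exists (f M) => t; rewrite -/(f t).
have /andP[k1 k2] := floor_itv (t / (pi *+ 2)).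
set k := Num.floor _ in k1 k2.
have -> : f t = f (t - k%:~R * (pi *+ 2)).
  by rewrite -[in LHS](subrK (k%:~R * (pi *+ 2)) t) (quasi_periodic_int fp) mulr0 addr0.
apply: fM; rewrite in_itv/= subr_ge0 -ler_pdivlMr// k1/=.
by move: k2; rewrite intrD ltr_pdivrMr//; lra.
Qed.

(** The factor [e] sets the direction of travel: log l stays below a constant minus k t, where k = -
    e J / (2 pi) > 0. *)
Lemma qp_spiral a b g J c (e : R) : (0 < a)%N -> (0 < b)%N ->
  growth_potential a b g J -> e * J < 0 ->
  qp_x a g c (e * t) @[t --> +oo] --> (0 : R) /\
  qp_y b g c (e * t) @[t --> +oo] --> (0 : R).
Proof.
move=> a0 b0 gJ eJ.
have [M gM] := potential_bound gJ.
have p0 : 0 < pi *+ 2 :> R by rewrite pmulrn_lgt0// pi_gt0.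
pose k := - (e * J) / (pi *+ 2).
have k0 : 0 < k by rewrite divr_gt0// oppr_gt0.
have small n (eps : R) : (0 < n)%N -> 0 < eps ->
    \forall t \near +oo, expR (g (e * t) + c) ^+ n < eps.
  move=> n0 eps0; near=> t.
  rewrite -expRM_natl -[ltRHS]lnK ?posrE// ltr_expR.
  rewrite -ltr_pdivlMl ?ltr0n//.
  have := gM (e * t).
  have -> : J / (pi *+ 2) * (e * t) = - (k * t).
    by rewrite /k; move: (pi *+ 2)^-1 => i; ring.
  have : (M + c - n%:R^-1 * ln eps) / k < t
    by near: t; apply: nbhs_pinfty_gt; rewrite num_real.
  by rewrite ltr_pdivrMr// mulrC; lra.
split; apply/cvgrPdist_lt => eps eps0.
- near=> t; rewrite sub0r normrN /qp_x normrM ger0_norm ?exprn_ge0 ?expR_ge0//.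
  apply: (@le_lt_trans _ _ (expR (g (e * t) + c) ^+ a)).
    by rewrite ler_piMr ?exprn_ge0 ?expR_ge0// cos_max.
  by near: t; exact: small.
- near=> t; rewrite sub0r normrN /qp_y normrM ger0_norm ?exprn_ge0 ?expR_ge0//.
  apply: (@le_lt_trans _ _ (expR (g (e * t) + c) ^+ b)).
    by rewrite ler_piMr ?exprn_ge0 ?expR_ge0// sin_max.
  by near: t; exact: small.
Unshelve. all: by end_near. Qed.

End Monodromic.

(** * Polynomial forms: evaluation, tangents, reduction of homogeneous forms *)

Section Forms.
Variable R : realType.
Implicit Types (p q f g : {mpoly R[2]}) (w : oneform R) (x y l : R) (z : R * R).

Lemma evalxyM p q z : evalxy (p * q) z = evalxy p z * evalxy q z.
Proof. exact: mevalM. Qed.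

Lemma evalxyB p q z : evalxy (p - q) z = evalxy p z - evalxy q z.
Proof. exact: mevalB. Qed.

Lemma evalxyD p q z : evalxy (p + q) z = evalxy p z + evalxy q z.
Proof. exact: mevalD. Qed.

Lemma evalxyZ x p z : evalxy (x *: p) z = x * evalxy p z.
Proof. exact: mevalZ. Qed.

Lemma evalxy_exp p n z : evalxy (p ^+ n) z = evalxy p z ^+ n.
Proof. exact: rmorphXn. Qed.

Lemma evalxy_X0 z : evalxy 'X_0 z = z.1.
Proof. exact: mevalXU. Qed.

Lemma evalxy_X1 z : evalxy 'X_1 z = z.2.
Proof. exact: mevalXU. Qed.

Lemma evalxy_comp p f g z :
  evalxy (p \mPo [tuple f; g]) z = evalxy p (evalxy f z, evalxy g z).
Proof.
rewrite /evalxy comp_mpoly_meval; apply: meval_eq => i.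
by case: i => [[|[|]]].
Qed.

Lemma evalxyE p z :
  evalxy p z = \sum_(m <- msupp p) p@_m * (z.1 ^+ m ord0 * z.2 ^+ m ord_max).
Proof.
rewrite /evalxy mevalE; apply: eq_bigr => m _.
rewrite big_ord_recl big_ord1 /=.
by rewrite (_ : lift ord0 ord0 = ord_max)//; apply: val_inj.
Qed.

Lemma mdeg2 (m : 'X_{1..2}) : mdeg m = (m ord0 + m ord_max)%N.
Proof.
rewrite mdegE big_ord_recl big_ord1.
by rewrite (_ : lift ord0 ord0 = ord_max)//; apply: val_inj.
Qed.

Lemma evalxy_homog p n l x y : p \is n.-homog ->
  evalxy p (l * x, l * y) = l ^+ n * evalxy p (x, y).
Proof.
move=> /dhomogP hp; rewrite !evalxyE mulr_sumr !big_seq; apply: eq_bigr => m mp.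
by rewrite /= -(hp m mp) /= mdeg2 !exprMn exprD; ring.
Qed.

Lemma continuous_evalxy p (X Y : R -> R) : continuous X -> continuous Y ->
  continuous (fun t => evalxy p (X t, Y t)).
Proof.
move=> cX cY.
have ck (k : R) : continuous (fun _ : R => k) by move=> t; exact: cvg_cst.
have -> : (fun t => evalxy p (X t, Y t)) = (fun t =>
    \sum_(m <- msupp p) p@_m * (X t ^+ m ord0 * Y t ^+ m ord_max)).
  by apply/funext => t; rewrite evalxyE.
elim: (msupp p) => [|m s IH].
  by under eq_fun do rewrite big_nil; exact: ck.
under eq_fun do rewrite big_cons.
apply: continuous_fD IH; apply: continuous_fM (ck _) _.
by apply: continuous_fM; exact: continuous_fX.
Qed.

Lemma mpolyX2 (m : 'X_{1..2}) :
  'X_[m] = 'X_0 ^+ m ord0 * 'X_1 ^+ m ord_max :> {mpoly R[2]}.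
Proof.
rewrite mpolyXE_id big_ord_recl big_ord1.
by congr ('X__ ^+ _ * 'X__ ^+ (m _)); apply: val_inj.
Qed.

(* Modulo the line L = b X - a Y, both X and Y are multiples of
   M = (a X + b Y) / (a^2 + b^2), which is 1 at (a, b). *)
Lemma homog_mod_line n p (a b : R) : p \is n.-homog -> 0 < a ^+ 2 + b ^+ 2 ->
  exists q c, [/\ q \is n.-1.-homog, n = 0 -> q = 0 &
    p = (b *: 'X_0 - a *: 'X_1) * q
        + c *: ((a ^+ 2 + b ^+ 2)^-1 *: (a *: 'X_0 + b *: 'X_1)) ^+ n].
Proof.
move=> hp N0; set L := _ - _; set N := a ^+ 2 + b ^+ 2; set M := _ *: _.
pose P n (p : {mpoly R[2]}) := exists q c, [/\ q \is n.-1.-homog, n = 0 -> q = 0 &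
  p = L * q + c *: M ^+ n].
have hX (i : 'I_2) : ('X_i : {mpoly R[2]}) \is 1.-homog by rewrite dhomogX /= mdeg1.
have hM k : M ^+ k \is k.-homog.
  rewrite -[X in X.-homog]mul1n; apply: dhomogMn.
  by apply: dhomogZ; apply: dhomogD; exact: dhomogZ.
have X0E : 'X_0 = a *: M + (b / N) *: L.
  transitivity ((a / N * a + b / N * b) *: 'X_0 + (a / N * b - b / N * a) *: 'X_1
      : {mpoly R[2]}).
    have -> : a / N * a + b / N * b = 1 by rewrite /N; field; rewrite gt_eqF.
    by rewrite mulrAC [b / N * a]mulrAC [b * a]mulrC subrr scale1r scale0r addr0.
  rewrite /M /L !scalerA scalerDr scalerBr !scalerA scalerDl scalerBl.
  by rewrite -!mul_mpolyC; ring.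
have X1E : 'X_1 = b *: M - (a / N) *: L.
  transitivity ((b / N * a - a / N * b) *: 'X_0 + (b / N * b + a / N * a) *: 'X_1
      : {mpoly R[2]}).
    have -> : b / N * b + a / N * a = 1 by rewrite /N; field; rewrite gt_eqF.
    by rewrite mulrAC [a / N * b]mulrAC [a * b]mulrC subrr scale1r scale0r add0r.
  rewrite /M /L !scalerA scalerDr scalerBr !scalerA scalerBl scalerDl.
  by rewrite -!mul_mpolyC; ring.
have step k Z r (u v : R) : Z \is 1.-homog -> Z = u *: M + v *: L ->
    P k r -> P k.+1 (Z * r).
  move=> hZ ZE [q [c [hq q0 rE]]].
  exists (Z * q + (c * v) *: M ^+ k), (c * u); split=> //=.
    apply: dhomogD; last exact: dhomogZ.
    (* At k = 0 the truncated predecessor gives the quotient degree 0 both before and after the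
       step, so [Z * q] would have degree 1; the clause q = 0 for n = 0 excludes this. *)
    case: k q0 hq {rE} => [q0 _|k _ hq]; first by rewrite q0// mulr0 dhomog0.
    exact: (dhomogM hZ hq).
  transitivity (L * (Z * q) + (u *: M + v *: L) * (c *: M ^+ k)).
    by rewrite -ZE rE mulrDr mulrCA.
  by rewrite exprS -!mul_mpolyC !mpolyCM; ring.
have mono i j : P (i + j)%N ('X_0 ^+ i * 'X_1 ^+ j).
  elim: i => [|i IH]; last first.
    by rewrite addSn exprS -mulrA; exact: (step _ _ _ _ _ (hX _) X0E).
  rewrite add0n mul1r; elim: j => [|j IH].
    by exists 0, 1; split; rewrite ?dhomog0// mulr0 add0r scale1r.
  rewrite exprS; apply: (step _ _ _ b (- (a / N)) (hX _) _ IH).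
  by rewrite X1E scaleNr.
have Padd r s : P n r -> P n s -> P n (r + s).
  move=> [q [c [hq q0 ->]]] [q' [c' [hq' q0' ->]]].
  exists (q + q'), (c + c'); split; first exact: dhomogD.
  - by move=> n0; rewrite q0// q0'// addr0.
  - by rewrite mulrDr scalerDl addrACA.
have Pscale r k : P n r -> P n (k *: r).
  move=> [q [c [hq q0 ->]]]; exists (k *: q), (k * c); split.
  - exact: dhomogZ.
  - by move=> n0; rewrite q0// scaler0.
  - by rewrite scalerDr scalerAr scalerA.
suff : P n p by [].
rewrite (mpolyE p) big_seq; elim/big_ind: _ => [|r s|m mp].
- by exists 0, 0; split; rewrite ?dhomog0// mulr0 scale0r addr0.
- exact: Padd.
- apply: Pscale; rewrite mpolyX2.
  by move/dhomogP: hp => /(_ m mp) /= <-; rewrite mdeg2; exact: mono.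
Qed.

(** At [(a, b)] the line vanishes and the other linear form is 1, so the coefficient of the
    remainder is the value of [p] there. The clause for n = 0 ends the descent in [homog_reduction]:
    a constant with a zero is 0. *)
Lemma homog_linear_factor n p (a b : R) : p \is n.-homog ->
  0 < a ^+ 2 + b ^+ 2 -> evalxy p (a, b) = 0 ->
  exists q, [/\ q \is n.-1.-homog, n = 0 -> q = 0 &
    p = (b *: 'X_0 - a *: 'X_1) * q].
Proof.
move=> hp N0 pab; have [q [c [hq q0 pE]]] := homog_mod_line hp N0.
exists q; split=> //.
suff c0 : c = 0 by rewrite pE c0 scale0r addr0.
move: pab; rewrite pE.
rewrite evalxyD evalxyM evalxyB !evalxyZ evalxy_X0 evalxy_X1 evalxy_exp evalxyZ.
rewrite evalxyD !evalxyZ evalxy_X0 evalxy_X1 /=.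
by rewrite [b * a]mulrC subrr mul0r add0r -!expr2 mulVf ?gt_eqF// expr1n mulr1.
Qed.

Lemma same_foliation_sym w w' : same_foliation w w' -> same_foliation w' w.
Proof. by move=> [A [B [A0 B0 e1 e2]]]; exists B, A; split. Qed.

Lemma same_foliation_refl w : same_foliation w w.
Proof. by exists 1, 1; split; rewrite ?oner_neq0. Qed.

Lemma same_foliation_trans w w' w'' :
  same_foliation w w' -> same_foliation w' w'' -> same_foliation w w''.
Proof.
move=> [A [B [A0 B0 e1 e2]]] [C [D [C0 D0 e3 e4]]].
exists (C * A), (B * D); split; rewrite ?mulf_neq0//.
- by rewrite -mulrA e1 mulrCA e3 mulrA.
- by rewrite -mulrA e2 mulrCA e4 mulrA.
Qed.

(** [A] and [B] are cancelled in the polynomial ring, before evaluation, so the relation also holds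
    where they vanish. *)
Lemma same_foliation_wedge w w' z : same_foliation w w' ->
  evalxy w.1 z * evalxy w'.2 z = evalxy w.2 z * evalxy w'.1 z.
Proof.
move=> [A [B [A0 B0 e1 e2]]]; rewrite -!evalxyM; congr (evalxy _ z).
apply: (mulfI (mulf_neq0 A0 B0)).
transitivity ((A * w.1) * (B * w'.2)); first by ring.
by rewrite e1 -e2; ring.
Qed.

Definition nonsingular w z := (evalxy w.1 z != 0) || (evalxy w.2 z != 0).

Lemma parallel_trans (p1 q1 p2 q2 u v : R) : (p2 != 0) || (q2 != 0) ->
  p1 * q2 = q1 * p2 -> p2 * v = q2 * u -> p1 * v = q1 * u.
Proof.
move=> /orP[p0|q0] E1 E2.
- by apply: (mulfI p0); rewrite mulrCA E2 mulrA E1 mulrAC mulrC.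
- by apply: (mulfI q0); rewrite mulrA [q2 * p1]mulrC E1 -mulrA E2 mulrCA.
Qed.

Lemma tangent_form w w' z (u : R * R) : same_foliation w w' -> tangent w z u ->
  evalxy w'.1 z * u.2 = evalxy w'.2 z * u.1.
Proof.
move=> ww' [w'' [ww'' ns /eqP]]; rewrite subr_eq0 => /eqP.
apply: parallel_trans ns _; apply: same_foliation_wedge.
exact: same_foliation_trans (same_foliation_sym ww') ww''.
Qed.

Lemma form_tangent w w' z (u : R * R) : same_foliation w w' ->
  nonsingular w' z -> evalxy w'.1 z * u.2 = evalxy w'.2 z * u.1 ->
  tangent w z u.
Proof. by move=> ww' ns E; exists w'; split=> //; rewrite E subrr. Qed.

Definition power_pullback (a b : nat) w : oneform R :=
  pullback ('X_0 ^+ b) ('X_1 ^+ a) w.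

Lemma mderiv_exp (i : 'I_2) p n : (p ^+ n)^`M(i) = n%:R *: (p ^+ n.-1 * p^`M(i)).
Proof.
elim: n => [|n IH]; first by rewrite expr0 scale0r -mpolyC1 mderivC.
rewrite exprS mderivM IH; case: n {IH} => [|n] /=.
  by rewrite !expr0 scale0r mulr0 addr0 mulr1 mul1r scale1r.
rewrite -scalerAr mulrA -exprS [X in _ = X%:R *: _]/= -[X in _ = X%:R *: _]addn1.
by rewrite natrD scalerDl scale1r addrC [_ ^+ n.+1 * _]mulrC.
Qed.

Lemma mderiv_var (i j : 'I_2) : ('X_i : {mpoly R[2]})^`M(j) = (i == j)%:R.
Proof.
rewrite mderivX mnm1E; case: eqP => [->|_]; last by rewrite scale0r.
rewrite (_ : (_ - _)%MM = 0%MM) ?mpolyX0 ?scale1r//.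
  by apply/mnmP => k; rewrite mnmBE subnn mnm0E.
Qed.

Lemma power_pullbackE a b w : power_pullback a b w =
  (a%:R *: ('X_1 ^+ a.-1 * (w.1 \mPo [tuple 'X_0 ^+ b; 'X_1 ^+ a])),
   b%:R *: ('X_0 ^+ b.-1 * (w.2 \mPo [tuple 'X_0 ^+ b; 'X_1 ^+ a]))).
Proof.
rewrite /power_pullback /pullback !mderiv_exp !mderiv_var /=.
rewrite !mulr1 !mulr0 !scaler0 !mulr0 !subr0.
by congr (_, _); rewrite -scalerAr mulrC.
Qed.

Lemma power_pullback1 w : power_pullback 1 1 w = w.
Proof.
rewrite power_pullbackE !expr0 !mul1r !scale1r !expr1.
have -> : [tuple 'X_0; 'X_1] = [tuple 'X_i | i < 2] :> 2.-tuple {mpoly R[2]}.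
  by apply: eq_from_tnth => i; rewrite tnth_mktuple;
    case: i => [[|[|]]] //= ?; congr 'X__; apply: val_inj.
by rewrite !comp_mpoly_id; case: w.
Qed.

Lemma evalxy_power_pullback a b w x y :
  (evalxy (power_pullback a b w).1 (x, y) =
     a%:R * y ^+ a.-1 * evalxy w.1 (x ^+ b, y ^+ a)) *
  (evalxy (power_pullback a b w).2 (x, y) =
     b%:R * x ^+ b.-1 * evalxy w.2 (x ^+ b, y ^+ a)).
Proof.
rewrite power_pullbackE; split; rewrite [LHS]evalxyZ evalxyM evalxy_comp.
- by rewrite !evalxy_exp evalxy_X0 evalxy_X1 mulrA.
- by rewrite !evalxy_exp evalxy_X0 evalxy_X1 mulrA.
Qed.

(* The coefficients may still have common factors, but only such as have no real
   zero outside the origin; this suffices to read tangents off w. *)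
Definition real_reduced w := forall x y : R, 0 < x ^+ 2 + y ^+ 2 ->
  nonsingular w (x, y).

(** Descent on the degree: a common real zero off the origin gives a common linear factor. One
    reduced form serves for all exponents, which lets the foliation and its pull-back be compared
    through it. *)
Lemma homog_reduction n w : w.1 \is n.-homog -> w.2 \is n.-homog ->
  (w.1 != 0) || (w.2 != 0) ->
  exists m (w' : oneform R), [/\ w'.1 \is m.-homog, w'.2 \is m.-homog,
    real_reduced w' & forall a b, (0 < a)%N -> (0 < b)%N ->
      same_foliation (power_pullback a b w) (power_pullback a b w')].
Proof.
elim: n w => [|n IH] w h1 h2 w0.
all: have [red|] := pselect (real_reduced w);
  first by eexists; exists w; split; [exact: h1|exact: h2|exact: red|
    move=> *; exact: same_foliation_refl].
all: move=> /existsNP[x /existsNP[y /not_implyP[xy0 /negP]]].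
all: rewrite negb_or !negbK => /andP[/eqP e1 /eqP e2].
all: have [q1 [hq1 q10 E1]] := homog_linear_factor h1 xy0 e1.
all: have [q2 [hq2 q20 E2]] := homog_linear_factor h2 xy0 e2.
  by move: w0; rewrite E1 E2 q10// q20// mulr0 eqxx.
have [|m [w' [h1' h2' red H]]] := IH (q1, q2) hq1 hq2.
  by move: w0; rewrite E1 E2 !mulf_eq0 !negb_or; case: (_ == 0) => //=.
exists m, w'; split; [exact: h1'|exact: h2'|exact: red|move=> a b a0 b0].
apply: same_foliation_trans (H a b a0 b0).
(* The pull-back of the divided line; its values y at (1, 0) and -x at (0, 1) show that it is not
   0. *)
pose L := (y *: 'X_0 - x *: 'X_1 : {mpoly R[2]}) \mPo
  [tuple ('X_0 ^+ b : {mpoly R[2]}); 'X_1 ^+ a].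
exists 1, L; split; first exact: oner_neq0.
- apply/eqP => L0.
  have ev u v : y * u ^+ b - x * v ^+ a = 0.
    have := congr1 (fun p => evalxy p (u, v)) L0.
    by rewrite evalxy_comp evalxyB !evalxyZ evalxy_X0 evalxy_X1 !evalxy_exp
      evalxy_X0 evalxy_X1 /= => ->; rewrite /evalxy meval0.
  have y0 := ev 1 0; rewrite expr1n expr0n gtn_eqF// mulr1 mulr0 subr0 in y0.
  have x0 := ev 0 1; rewrite expr1n expr0n gtn_eqF// mulr1 mulr0 sub0r in x0.
  by move: xy0; rewrite y0 -[x]opprK x0 oppr0 expr0n addr0 ltxx.
- rewrite mul1r !power_pullbackE /= E1 rmorphM -/L.
  by rewrite -scalerAr mulrCA.
- rewrite mul1r !power_pullbackE /= E2 rmorphM -/L.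
  by rewrite -scalerAr mulrCA.
Qed.

End Forms.

(** * Propagation of zeros under a linear differential inequality *)

Section LinearODE.
Variable R : realType.
Implicit Types (f df : R -> R) (s t u v k C : R).

Lemma zero_segment f df C s t : s <= t -> (forall u, is_derive u 1 f (df u)) ->
  (forall u, s <= u <= t -> `|df u| <= C * `|f u|) ->
  (f s = 0 -> f t = 0) /\ (f t = 0 -> f s = 0).
Proof.
move=> st fd bound.
(* Gronwall: |df| <= C |f| makes f^2 exp(-2 C u) nonincreasing and f^2 exp(2 C u)
   nondecreasing. *)
pose E (k : R) u := f u ^+ 2 * expR (k * u).
pose dE (k : R) u := (2 * f u * df u + k * f u ^+ 2) * expR (k * u).
have Ed k u : is_derive u 1 (E k) (dE k u).
  apply: (is_derive_ext (is_derive_fM (is_derive_fX 2 (fd u))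
    (is_derive_fexp (is_derive_fM (is_derive_const k u) (is_derive_ident u))))) => //.
  by rewrite /dE /= expr1; ring.
have cE k : {within `[s, t], continuous (E k)}.
  apply: continuous_subspaceT => u; exact: is_derive_continuous (Ed k u).
have prod_bound u : s <= u <= t -> `|2 * f u * df u| <= 2 * C * f u ^+ 2.
  move=> /bound ub; rewrite !normrM ger0_norm// -[f u ^+ 2]ger0_norm ?sqr_ge0//.
  rewrite normrX expr2; have := normr_ge0 (f u) => f0; nra.
have E0 k u : E k u <= 0 -> f u = 0.
  rewrite /E pmulr_lle0 ?expR_gt0// => fu.
  by apply/eqP; rewrite -sqrf_eq0 eq_le fu sqr_ge0.
split=> f0.
- have [c cst E1] := MVT_segment st (fun u _ => Ed (- 2 * C) u) (@cE _).
  apply: (E0 (- 2 * C)); have -> : E (- 2 * C) t = dE (- 2 * C) c * (t - s).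
    by rewrite -E1 /E f0 expr0n mul0r subr0.
  rewrite mulr_le0_ge0 ?subr_ge0// /dE pmulr_lle0 ?expR_gt0//.
  move: cst; rewrite in_itv/= => /prod_bound.
  by have := ler_norm (2 * f c * df c); lra.
- have [c cst E1] := MVT_segment st (fun u _ => Ed (2 * C) u) (@cE _).
  apply: (E0 (2 * C)); have -> : E (2 * C) s = - (dE (2 * C) c * (t - s)).
    by rewrite -E1 opprB /E f0 expr0n mul0r subr0.
  rewrite oppr_le0 mulr_ge0 ?subr_ge0// /dE pmulr_lge0 ?expR_gt0//.
  move: cst; rewrite in_itv/= => /prod_bound.
  by have := ler_norm (- (2 * f c * df c)); rewrite normrN; lra.
Qed.

(** The zero set is closed by continuity and open by the estimate around each zero, and the real
    line is connected. The constant may depend on the zero. *)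
Lemma zero_spreads f df s t : (forall u, is_derive u 1 f (df u)) ->
  (forall u, f u = 0 -> exists C, \forall v \near u, `|df v| <= C * `|f v|) ->
  f s = 0 -> f t = 0.
Proof.
move=> fd bound fs.
have cf : continuous f by move=> u; exact: is_derive_continuous (fd u).
have conn : connected [set: R] by apply/connected_intervalP.
suff : [set u | f u = 0] = [set: R] by move=> /seteqP[_ /(_ t I)].
apply: conn; first by exists s.
- exists [set u | f u = 0]; last by rewrite setTI.
  move=> u fu; have [C /nbhs_ballP[e /= e0 eC]] := bound u fu.
  apply/nbhs_ballP; exists e => //= v uv.
  have ball_le w : `|u - w| <= `|u - v| -> `|df w| <= C * `|f w|.
    by move=> uw; apply: eC; rewrite /ball/=; exact: le_lt_trans uw uv.
  case: (leP u v) => uv'.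
  + apply: (zero_segment uv' fd _).1 fu.
    move=> w /andP[uw wv]; apply: ball_le.
    by rewrite !ler0_norm ?subr_le0//; lra.
  + apply: (zero_segment (ltW uv') fd _).2 fu.
    move=> w /andP[vw wu]; apply: ball_le.
    by rewrite !ger0_norm ?subr_ge0//; lra.
- exists [set u | f u = 0]; last by rewrite setTI.
  rewrite (_ : [set u | f u = 0] = f @^-1` [set 0])//.
  by apply: closed_comp => //; exact: closed1.
Qed.

End LinearODE.

(** * Invariant curves as an obstruction to winding *)

Section InvariantCurve.
Variable R : realType.
Implicit Types (w : oneform R) (x y : R -> R) (a b : R) (i j : nat).

(** The cofactor equation P f_x + Q f_y = K f of an invariant algebraic curve, for f = b u^i - a
    v^j. The form and the cofactor may depend on the point of the curve, where the form must not
    vanish. *)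
Definition invariant_binomial w b i a j :=
  forall u v : R, 0 < u ^+ 2 + v ^+ 2 -> b * u ^+ i - a * v ^+ j = 0 ->
    exists w' K, [/\ same_foliation w w', nonsingular w' (u, v) &
      forall u v, b * (i%:R * u ^+ i.-1) * evalxy w'.1 (u, v)
                  - a * (j%:R * v ^+ j.-1) * evalxy w'.2 (u, v)
                  = evalxy K (u, v) * (b * u ^+ i - a * v ^+ j)].

Lemma leaf_curveP w U x y : leaf_curve w U x y ->
  [/\ forall t : R, is_derive t 1 x (derive1 x t),
      forall t : R, is_derive t 1 y (derive1 y t),
      continuous x & continuous y].
Proof.
case=> d _ _ _ _.
have xd (t : R) : is_derive t 1 x (derive1 x t).
  by rewrite derive1E; exact: derivableP (d t).1.
have yd (t : R) : is_derive t 1 y (derive1 y t).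
  by rewrite derive1E; exact: derivableP (d t).2.
by split=> // t; [exact: is_derive_continuous (xd t)|exact: is_derive_continuous (yd t)].
Qed.

Lemma pair_neq0 (U : set (R * R)) (u v : R) : (U `\ (0, 0)) (u, v) ->
  0 < u ^+ 2 + v ^+ 2.
Proof.
move=> [_ /= uv]; apply: sumr_sqr_gt0; rewrite -negb_and; apply/negP.
by move=> /andP[/eqP u0 /eqP v0]; apply: uv; rewrite u0 v0.
Qed.

Lemma invariant_binomial_leaf w b i a j U x y (s t : R) :
  invariant_binomial w b i a j -> leaf_curve w (U `\ (0, 0)) x y ->
  b * x s ^+ i - a * y s ^+ j = 0 -> b * x t ^+ i - a * y t ^+ j = 0.
Proof.
move=> inv leaf.
have [xd yd cx cy] := leaf_curveP leaf.
have [_ [cdx cdy] _ inU tang] := leaf.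
set f := fun t => b * x t ^+ i - a * y t ^+ j.
pose df t := b * (i%:R * x t ^+ i.-1 * derive1 x t)
             - a * (j%:R * y t ^+ j.-1 * derive1 y t).
have fd (u : R) : is_derive u 1 f (df u).
  apply: (is_derive_ext (is_derive_fB
    (is_derive_fM (is_derive_const b u) (is_derive_fX i (xd u)))
    (is_derive_fM (is_derive_const a u) (is_derive_fX j (yd u))))) => //.
  by rewrite /df !mul0r !add0r.
rewrite -/(f s) -/(f t); apply: zero_spreads fd _ => u fu.
have [w' [K [ww' ns cof]]] := inv _ _ (pair_neq0 (inU u)) fu.
pose P v := evalxy w'.1 (x v, y v); pose Q v := evalxy w'.2 (x v, y v).
have cP : continuous P by exact: continuous_evalxy.
have cQ : continuous Q by exact: continuous_evalxy.
have cK : continuous (fun v => evalxy K (x v, y v)) by exact: continuous_evalxy.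
have cN : continuous (fun v => P v ^+ 2 + Q v ^+ 2).
  by apply: continuous_fD; exact: continuous_fX.
have N0 : 0 < P u ^+ 2 + Q u ^+ 2 by exact: sumr_sqr_gt0.
(* The speed factor, obtained by projection: (x', y') = k (P, Q) wherever (P, Q) is not 0. With the
   cofactor equation it gives f' = k K f near the zero [u]. *)
pose k v := (derive1 x v * P v + derive1 y v * Q v) / (P v ^+ 2 + Q v ^+ 2).
pose h v := k v * evalxy K (x v, y v).
have ch : {for u, continuous h}.
  apply: cvgM; last exact: cK.
  apply: cvgM.
    by apply: (continuous_fD (continuous_fM cdx cP) (continuous_fM cdy cQ)).
  by apply: cvgV; [rewrite gt_eqF|exact: cN].
exists (`|h u| + 1); near=> v.
have Nv : 0 < P v ^+ 2 + Q v ^+ 2.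
  by near: v; apply: (@cvgr_gt _ _ _ _ _ _ (cN u)).
have hv : `|h v| <= `|h u| + 1.
  have : `|h u - h v| < 1 by near: v; exact: cvgr_dist_lt.
  by have := ler_normB (h u) (h u - h v); rewrite opprB addrC subrK; lra.
suff -> : df v = h v * f v by rewrite normrM ler_wpM2r.
have tg := tangent_form ww' (tang v); rewrite /= -/(P v) -/(Q v) in tg.
have xv : derive1 x v = k v * P v.
  rewrite /k; apply: (mulIf (lt0r_neq0 Nv)).
  rewrite mulrAC divfK ?gt_eqF//.
  by rewrite mulrDl -[_ * Q v * P v]mulrA [Q v * P v]mulrC mulrA
    [_ * P v]mulrC tg; ring.
have yv : derive1 y v = k v * Q v.
  rewrite /k; apply: (mulIf (lt0r_neq0 Nv)).
  rewrite mulrAC divfK ?gt_eqF//.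
  transitivity (P v * derive1 y v * P v + derive1 y v * Q v * Q v); first by ring.
  by rewrite tg; ring.
rewrite /h /f -[k v * _ * _]mulrA -cof -/(P v) -/(Q v) /df xv yv; ring.
Unshelve. all: by end_near. Qed.

Lemma invariant_binomial_no_winding w b i a j U x y : (0 < i)%N -> (0 < j)%N ->
  (b != 0) && odd i || (a != 0) && odd j ->
  invariant_binomial w b i a j -> leaf_curve w (U `\ (0, 0)) x y ->
  ~ winds x y.
Proof.
move=> i0 j0 odd_ab inv leaf xy.
have [_ _ cx cy] := leaf_curveP leaf.
pose f t := b * x t ^+ i - a * y t ^+ j.
have cf : continuous f.
  have ck (k : R) : continuous (fun _ : R => k) by move=> t; exact: cvg_cst.
  by apply: continuous_fB; apply: continuous_fM (ck _) _; exact: continuous_fX.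
have never v t : f v = 0 -> f t = 0 by apply: invariant_binomial_leaf inv leaf.
(* Opposite signs produce a zero of [f] along the leaf; then [f] vanishes on the whole leaf, against
   the strict sign. *)
suff [s [t fst]] : exists s t, f s * f t < 0.
  have [v fv] : exists v, f v = 0.
    case: (ltP (f s) 0) => fs.
      by apply: (IVT_unordered (s := s) (t := t) cf); apply/andP; split; nra.
    by apply: (IVT_unordered (s := t) (t := s) cf); apply/andP; split; nra.
  by move: fst; rewrite (never v s fv) mul0r ltxx.
have sq (c r s : R) n : c != 0 -> 0 < r -> 0 < s -> odd n ->
    (c * r ^+ n) * (c * (- s) ^+ n) < 0.
  move=> c0 r0 s0 on; rewrite exprNn -signr_odd on expr1 mulN1r.
  rewrite mulrN mulrN oppr_lt0 mulrACA -expr2.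
  apply: mulr_gt0; first by rewrite lt0r sqrf_eq0 c0 sqr_ge0.
  by apply: mulr_gt0; exact: exprn_gt0.
case/orP: odd_ab => /andP[c0 on].
- have [s [r [r0 xs ys]]] := winds_direction 0 xy.
  have [t [r' [r'0 xt yt]]] := winds_direction pi xy.
  exists s, t; rewrite /f xs ys xt yt cos0 sin0 cospi sinpi !mulr0 mulr1 mulrN1.
  by rewrite !expr0n !gtn_eqF// !mulr0 !subr0; exact: sq.
- have [s [r [r0 xs ys]]] := winds_direction (pi / 2) xy.
  have [t [r' [r'0 xt yt]]] := winds_direction (- (pi / 2)) xy.
  exists s, t; rewrite /f xs ys xt yt cosN sinN cos_pihalf sin_pihalf.
  rewrite !mulr0 mulr1 mulrN1 !expr0n !gtn_eqF// !mulr0 !sub0r mulrNN.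
  exact: sq.
Qed.

(* If p or q is 0, the characteristic line is an axis, on which the pull-back form
   may vanish identically; a power of the axis coordinate is then divided out. *)
Lemma characteristic_invariant m w (p q : R) (a b : nat) :
  w.1 \is m.-homog -> w.2 \is m.-homog -> real_reduced w ->
  0 < p ^+ 2 + q ^+ 2 -> p * evalxy w.2 (p, q) = q * evalxy w.1 (p, q) ->
  (0 < a)%N -> (0 < b)%N -> odd a || odd b ->
  exists c i d j, [/\ (0 < i)%N, (0 < j)%N,
    (c != 0) && odd i || (d != 0) && odd j &
    invariant_binomial (power_pullback a b w) c i d j].
Proof.
move=> h1 h2 red pq0 Fpq a0 b0 oab.
have pow0 (u : R) n : (0 < n)%N -> u ^+ n = u * u ^+ n.-1.
  by move=> n0; rewrite -exprS prednK.
have pow_pos_l (u v : R) : u != 0 -> 0 < (u ^+ b) ^+ 2 + (v ^+ a) ^+ 2.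
  by move=> u0; apply: sumr_sqr_gt0; rewrite expf_neq0.
have pow_pos_r (u v : R) : v != 0 -> 0 < (u ^+ b) ^+ 2 + (v ^+ a) ^+ 2.
  by move=> v0; apply: sumr_sqr_gt0; rewrite (expf_neq0 a v0) orbT.
pose comp (r : {mpoly R[2]}) := r \mPo [tuple ('X_0 ^+ b : {mpoly R[2]}); 'X_1 ^+ a].
have compE r u v : evalxy (comp r) (u, v) = evalxy r (u ^+ b, v ^+ a).
  by rewrite /comp evalxy_comp !evalxy_exp evalxy_X0 evalxy_X1.
have X_neq0 (i : 'I_2) n : ('X_i : {mpoly R[2]}) ^+ n != 0.
  apply/eqP => /(congr1 (meval (fun=> 1 : R))).
  by rewrite rmorphXn /= mevalXU expr1n meval0 => /eqP; rewrite oner_eq0.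
have comp0 (c : R) r : comp (c *: 'X_0 * r) = c *: ('X_0 ^+ b.-1 * 'X_0) * comp r.
  by rewrite /comp rmorphM /= comp_mpolyZ comp_mpolyXU /= -exprSr prednK.
have comp1 (c : R) r : comp (c *: 'X_1 * r) = c *: ('X_1 ^+ a.-1 * 'X_1) * comp r.
  by rewrite /comp rmorphM /= comp_mpolyZ comp_mpolyXU /= -exprSr prednK.
have [p0|p0] := eqVneq p 0.
  have q0 : q != 0 by apply: contraTneq pq0 => ->; rewrite p0 expr0n addr0 ltxx.
  have P0 : evalxy w.1 (p, q) = 0.
    by move/eqP: Fpq; rewrite p0 mul0r eq_sym mulf_eq0 (negPf q0) => /eqP.
  have [r [_ _]] := homog_linear_factor h1 pq0 P0.
  rewrite p0 scale0r subr0 => rE.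
  (* The axis is described with exponent 1 instead of [b], so that [f] changes sign across it even
     for even [b]. *)
  exists q, 1%N, 0, 1%N; split=> //; first by rewrite q0.
  move=> u v uv0; rewrite mul0r subr0 expr1 => /eqP.
  rewrite mulf_eq0 (negPf q0) /= => /eqP u0.
  have v0 : v != 0 by apply: contraTneq uv0 => ->; rewrite u0 expr0n addr0 ltxx.
  exists (a%:R *: ('X_1 ^+ a.-1 * (q *: 'X_0 * comp r)), b%:R *: comp w.2),
    ((a%:R * q) *: ('X_1 ^+ a.-1 * comp r)).
  split.
  - exists 1, ('X_0 ^+ b.-1); split; rewrite ?oner_neq0// mul1r power_pullbackE.
    + rewrite -/(comp w.1) /= rE comp0 -scalerAr; congr (_ *: _).
      by rewrite -!scalerAl -!scalerAr; congr (_ *: _); ring.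
    + by rewrite /= -scalerAr.
  (* The first coefficient of [w] vanishes on this axis, so reducedness makes the second one
     non-zero there. *)
  - rewrite /nonsingular /= [X in _ || X](_ : _ = true) ?orbT//.
    rewrite evalxyZ compE mulf_eq0 pnatr_eq0 gtn_eqF//=.
    have := red _ _ (pow_pos_r u v v0); rewrite /nonsingular rE evalxyM evalxyZ.
    by rewrite evalxy_X0 /= u0 expr0n gtn_eqF// mulr0 mul0r eqxx.
  - move=> s t; rewrite !mul0r !subr0 !expr0 mulr1 mulr1 /=.
    by rewrite !evalxyZ !evalxyM evalxyZ evalxy_X0 /=; ring.
have [q0|q0] := eqVneq q 0.
  have Q0 : evalxy w.2 (p, q) = 0.
    by move/eqP: Fpq; rewrite q0 mul0r mulf_eq0 (negPf p0) => /eqP.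
  have [r [_ _]] := homog_linear_factor h2 pq0 Q0.
  rewrite q0 scale0r sub0r -scaleNr => rE.
  exists 0, 1%N, p, 1%N; split=> //; first by rewrite p0 orbT.
  move=> u v uv0; rewrite mul0r sub0r expr1 => /eqP.
  rewrite oppr_eq0 mulf_eq0 (negPf p0) /= => /eqP v0.
  have u0 : u != 0 by apply: contraTneq uv0 => ->; rewrite v0 expr0n addr0 ltxx.
  exists (a%:R *: comp w.1, b%:R *: ('X_0 ^+ b.-1 * (- p *: 'X_1 * comp r))),
    ((b%:R * - p) *: ('X_0 ^+ b.-1 * comp r)).
  split.
  - exists 1, ('X_1 ^+ a.-1); split; rewrite ?oner_neq0// mul1r power_pullbackE.
    + by rewrite /= -scalerAr.
    + rewrite -/(comp w.2) /= rE comp1 -scalerAr; congr (_ *: _).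
      by rewrite -!scalerAl -!scalerAr; congr (_ *: _); ring.
  - rewrite /nonsingular /= [X in X || _](_ : _ = true)//.
    rewrite evalxyZ compE mulf_eq0 pnatr_eq0 gtn_eqF//=.
    have := red _ _ (pow_pos_l u v u0); rewrite /nonsingular rE evalxyM evalxyZ.
    by rewrite evalxy_X1 /= v0 expr0n gtn_eqF// mulr0 mul0r eqxx orbF.
  - move=> s t; rewrite !mul0r !sub0r !expr0 mulr1 mulr1 /=.
    by rewrite !evalxyZ !evalxyM evalxyZ evalxy_X1 /=; ring.
(* The derivative of the line along the homogeneous form vanishes at [(p, q)], so the line divides
   it. Pulling back the quotient yields the cofactor. *)
have h : q *: w.1 - p *: w.2 \is m.-homog.
  by rewrite rpredB//; exact: dhomogZ.
have z : evalxy (q *: w.1 - p *: w.2) (p, q) = 0.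
  by rewrite evalxyB !evalxyZ Fpq subrr.
have [r [_ _ rE]] := homog_linear_factor h pq0 z.
exists q, b, p, a; split=> //; first by rewrite p0 q0 orbC.
move=> u v uv0 fuv.
exists (power_pullback a b w), ((a%:R * b%:R) *: ('X_0 ^+ b.-1 * 'X_1 ^+ a.-1 * comp r)).
split; first exact: same_foliation_refl.
- have u0 : u != 0.
    apply: contraTneq uv0 => u0; move: fuv; rewrite u0 !expr0n gtn_eqF// mulr0 sub0r.
    move/eqP; rewrite oppr_eq0 mulf_eq0 (negPf p0) expf_eq0 a0 /= => /eqP ->.
    by rewrite expr0n addr0 ltxx.
  have v0 : v != 0.
    apply: contraNneq u0 => v0; move: fuv; rewrite v0 !expr0n gtn_eqF// mulr0 subr0.
    by move/eqP; rewrite mulf_eq0 (negPf q0) expf_eq0 b0 /=.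
  rewrite /nonsingular !evalxy_power_pullback !mulf_eq0 !pnatr_eq0 !expf_eq0.
  rewrite (negPf u0) (negPf v0) !andbF !gtn_eqF//=.
  exact: red (pow_pos_l u v u0).
- move=> s t; rewrite !evalxy_power_pullback evalxyZ !evalxyM !evalxy_exp.
  rewrite evalxy_X0 evalxy_X1 compE /=.
  have := congr1 (fun r => evalxy r (s ^+ b, t ^+ a)) rE.
  rewrite evalxyB evalxyM evalxyB !evalxyZ evalxy_X0 evalxy_X1 /= => E.
  transitivity (a%:R * b%:R * (s ^+ b.-1 * t ^+ a.-1) *
    (q * evalxy w.1 (s ^+ b, t ^+ a) - p * evalxy w.2 (s ^+ b, t ^+ a))); first by ring.
  by rewrite E; ring.
Qed.

End InvariantCurve.

(** * From growth to centers and foci, and back *)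

Section Leaves.
Variable R : realType.
Implicit Types (w : oneform R) (x y : R -> R) (a b : nat).

(** Consequences of a center or a focus are drawn from a single leaf. *)
Lemma all_leaves_exists w C : all_leaves_near_origin w C ->
  exists U x y, leaf_curve w (U `\ (0, 0)) x y /\ C x y.
Proof.
move=> [U /nbhs_ballP[e /= e0 eU] H].
have [|e2|x [y [leaf _ Cxy]]] := H (e / 2, 0).
- apply: eU; split => /=; first last.
    by rewrite /ball/= subrr normr0.
  by rewrite /ball/= sub0r normrN gtr0_norm; lra.
- by case: e2; lra.
- by exists U, x, y.
Qed.

Lemma leaf_curve_rescale w U x y (e : R) : e != 0 -> leaf_curve w U x y ->
  leaf_curve w U (fun t => x (e * t)) (fun t => y (e * t)).
Proof.
move=> e0 leaf; have [xd yd _ _] := leaf_curveP leaf.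
have [_ [cdx cdy] reg inU tang] := leaf.
have ed (t : R) : is_derive t 1 (fun t => e * t) e.
  apply: (is_derive_ext (is_derive_fM (is_derive_const e t) (is_derive_ident t))) => //.
  by rewrite mul0r add0r mulr1.
have xed (t : R) := is_derive_fcomp (ed t) (xd (e * t)).
have yed (t : R) := is_derive_fcomp (ed t) (yd (e * t)).
have dxE : derive1 (fun t => x (e * t)) = (fun t => derive1 x (e * t) * e).
  by apply/funext => t; rewrite derive1E; have [_ ->] := xed t.
have dyE : derive1 (fun t => y (e * t)) = (fun t => derive1 y (e * t) * e).
  by apply/funext => t; rewrite derive1E; have [_ ->] := yed t.
have ce : continuous (fun t : R => e * t).
  by move=> t; exact: is_derive_continuous (ed t).
have ck : continuous (fun _ : R => e) by move=> t; exact: cvg_cst.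
split.
- by move=> t; split; [have [] := xed t|have [] := yed t].
- rewrite dxE dyE; split.
  + exact: continuous_fM (continuous_fcomp ce cdx) ck.
  + exact: continuous_fM (continuous_fcomp ce cdy) ck.
- by move=> t; rewrite dxE dyE !mulf_eq0 !negb_or e0 !andbT.
- by move=> t; exact: inU.
- move=> t; rewrite dxE dyE; have [w' [ww' ns /= E]] := tang (e * t).
  exists w'; split=> //=; rewrite !mulrA -mulrBl.
  by rewrite E mul0r.
Qed.

Section Reduced.
Variables (m : nat) (w0 : oneform R).
Hypotheses (P_hom : w0.1 \is m.-homog) (Q_hom : w0.2 \is m.-homog).
Let p (x y : R) := evalxy w0.1 (x, y).
Let q (x y : R) := evalxy w0.2 (x, y).
Hypothesis mono : forall x y : R, 0 < x ^+ 2 + y ^+ 2 -> x * q x y - y * p x y != 0.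

Let p_hom (l x y : R) : p (l * x) (l * y) = l ^+ m * p x y.
Proof. exact: evalxy_homog. Qed.

Let q_hom (l x y : R) : q (l * x) (l * y) = l ^+ m * q x y.
Proof. exact: evalxy_homog. Qed.

Let p_cont x y : continuous x -> continuous y -> continuous (fun t => p (x t) (y t)).
Proof. exact: continuous_evalxy. Qed.

Let q_cont x y : continuous x -> continuous y -> continuous (fun t => q (x t) (y t)).
Proof. exact: continuous_evalxy. Qed.

(** Contracting the pull-back with the weighted Euler field (a u, b v) gives a b (x q - y p) at
    (u^b, v^a), which is not 0. *)
Lemma power_pullback_nonsingular a b (u v : R) : (0 < a)%N -> (0 < b)%N ->
  0 < u ^+ 2 + v ^+ 2 -> nonsingular (power_pullback a b w0) (u, v).
Proof.
move=> a0 b0 uv; rewrite /nonsingular -negb_and; apply/negP => /andP[].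
rewrite !evalxy_power_pullback => /eqP P0 /eqP Q0.
have : 0 < (u ^+ b) ^+ 2 + (v ^+ a) ^+ 2.
  apply: sumr_sqr_gt0; rewrite !expf_eq0 a0 b0 /=.
  have := uv; case: eqP => // ->; case: eqP => // ->.
  by rewrite expr0n addr0 ltxx.
move/mono => /negP; apply.
have ab0 : a%:R * b%:R != 0 :> R by rewrite mulf_neq0 ?pnatr_eq0 -?lt0n.
apply/eqP/(mulfI ab0); rewrite mulr0.
have [-> ->] : u ^+ b = u * u ^+ b.-1 /\ v ^+ a = v * v ^+ a.-1.
  by rewrite -!exprS !prednK.
transitivity (a%:R * u * (b%:R * u ^+ b.-1 * q (u * u ^+ b.-1) (v * v ^+ a.-1))
  - b%:R * v * (a%:R * v ^+ a.-1 * p (u * u ^+ b.-1) (v * v ^+ a.-1))); first by ring.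
by rewrite /q /p -!exprS !prednK// P0 Q0 !mulr0 subrr.
Qed.

Lemma qp_leaf a b g J c w : (0 < a)%N -> (0 < b)%N ->
  growth_potential p q a b g J -> same_foliation w (power_pullback a b w0) ->
  leaf_curve w (setT `\ (0, 0)) (qp_x a g c) (qp_y b g c).
Proof.
move=> a0 b0 gJ ww.
have xd (t : R) := is_derive_qp_x c gJ t.
have yd (t : R) := is_derive_qp_y c gJ t.
have dxE : derive1 (qp_x a g c) = qp_dx p q a b g c.
  by apply/funext => t; rewrite derive1E; have [_ ->] := xd t.
have dyE : derive1 (qp_y b g c) = qp_dy p q a b g c.
  by apply/funext => t; rewrite derive1E; have [_ ->] := yd t.
split.
- by move=> t; split; [have [] := xd t|have [] := yd t].
- rewrite dxE dyE; split.
  + exact: (continuous_qp_dx p_cont q_cont mono a0 b0 gJ).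
  + exact: (continuous_qp_dy p_cont q_cont mono a0 b0 gJ).
- by move=> t; rewrite dxE dyE; exact: qp_regular.
- move=> t; split=> //= -[x0 y0]; have := qp_neq0 a b g c t.
  by rewrite x0 y0 expr0n addr0 ltxx.
- move=> t; apply: (form_tangent ww).
    exact: power_pullback_nonsingular (qp_neq0 a b g c t).
  rewrite !evalxy_power_pullback dxE dyE.
  exact: (qp_tangent p_hom q_hom mono g c a0 b0 t).
Qed.

Lemma zero_growth_center a b g J w : (0 < a)%N -> (0 < b)%N ->
  growth_potential p q a b g J -> J = 0 ->
  same_foliation w (power_pullback a b w0) -> has_center w.
Proof.
move=> a0 b0 gJ J0 ww; exists setT; first exact: filterT.
move=> [u v] _ uv0.
have uv : 0 < u ^+ 2 + v ^+ 2 by apply: (@pair_neq0 _ setT).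
have [c [t [xt yt]]] := qp_through g a0 b0 uv.
exists (qp_x a g c), (qp_y b g c); split.
- exact: qp_leaf gJ ww.
- by exists t; rewrite xt yt.
- exact: (qp_closed p_cont q_cont mono c a0 b0 gJ J0).
Qed.

Lemma nonzero_growth_focus g J w :
  growth_potential p q 1 1 g J -> J != 0 ->
  same_foliation w (power_pullback 1 1 w0) -> has_focus w.
Proof.
move=> gJ J0 ww; exists setT; first exact: filterT.
move=> [u v] _ uv0.
have uv : 0 < u ^+ 2 + v ^+ 2 by apply: (@pair_neq0 _ setT).
have [c [t [xt yt]]] := qp_through g (ltn0Sn 0) (ltn0Sn 0) uv.
(* Time runs in the direction in which the radius shrinks. With unit weights the angle along the
   leaf is exactly e t. *)
pose e : R := - Num.sg J.
have e0 : e != 0 by rewrite oppr_eq0 sgr_eq0.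
have eJ : e * J < 0 by rewrite mulNr oppr_lt0 -normrEsg normr_gt0.
exists (fun t => qp_x 1 g c (e * t)), (fun t => qp_y 1 g c (e * t)); split.
- by apply: leaf_curve_rescale => //; exact: qp_leaf gJ ww.
- by exists (e^-1 * t); rewrite mulVKf// xt yt.
- exists (fun t => e * t).
  have [x0 y0] := qp_spiral c (ltn0Sn 0) (ltn0Sn 0) gJ eJ.
  split=> //.
  + split=> [|s]; first by move=> s; apply: cvgM; [exact: cvg_cst|exact: cvg_id].
    exists (expR (g (e * s) + c)); split; first exact: expR_gt0.
    * by rewrite /qp_x expr1.
    * by rewrite /qp_y expr1.
  + rewrite /e; case: (ltgtP J 0) J0 => // Js _.
    * rewrite ltr0_sg// opprK; left; under eq_fun do rewrite mul1r.
      exact: cvg_id.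
    * rewrite gtr0_sg//; right; apply/cvgNry.
      rewrite (_ : - _ = id); first exact: cvg_id.
      by apply/funext => s; rewrite -[LHS]/(- (- 1 * s)) mulN1r opprK.
Qed.

(** The center is that of the pull-back while [J] belongs to the homogeneous form; exponents 1, 1
    give the homogeneous foliation itself. *)
Lemma center_zero_growth a b g J w : odd a -> odd b ->
  growth_potential p q 1 1 g J ->
  same_foliation w (power_pullback a b w0) -> has_center w -> J = 0.
Proof.
move=> oa ob gJ ww /all_leaves_exists[U [x [y [leaf cl]]]].
have [xd yd _ _] := leaf_curveP leaf.
have [_ [cdx cdy] _ inU tang] := leaf.
have xy0 t : 0 < x t ^+ 2 + y t ^+ 2 by exact: pair_neq0 (inU t).
have tg (t : R) : a%:R * y t ^+ a.-1 * p (x t ^+ b) (y t ^+ a) * derive1 y t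
    = b%:R * x t ^+ b.-1 * q (x t ^+ b) (y t ^+ a) * derive1 x t.
  by have := tangent_form ww (tang t); rewrite !evalxy_power_pullback.
exact: (closed_growth p_hom q_hom mono oa ob gJ xd yd cdx cdy xy0 tg cl).
Qed.

End Reduced.

Lemma characteristic_no_winding m w0 (p q : R) a b w U x y :
  w0.1 \is m.-homog -> w0.2 \is m.-homog -> real_reduced w0 ->
  0 < p ^+ 2 + q ^+ 2 -> p * evalxy w0.2 (p, q) = q * evalxy w0.1 (p, q) ->
  (0 < a)%N -> (0 < b)%N -> odd a || odd b ->
  same_foliation w (power_pullback a b w0) ->
  leaf_curve w (U `\ (0, 0)) x y -> ~ winds x y.
Proof.
move=> h1 h2 red pq0 Fpq a0 b0 oab ww.
have [c [i [d [j [i0 j0 od inv]]]]] :=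
  characteristic_invariant h1 h2 red pq0 Fpq a0 b0 oab.
apply: (invariant_binomial_no_winding (b := c) (i := i) (a := d) (j := j)) => //.
move=> u v uv0 E; have [w' [K [ww' ns H]]] := inv u v uv0 E.
by exists w', K; split=> //; exact: same_foliation_trans ww ww'.
Qed.

End Leaves.

Set Strict Implicit.
Unset Implicit Arguments.

Theorem theorem2p8 (R : realType) (s1 s2 n : nat)
    (P Q Pstar Qstar : {mpoly R[2]})
    (hs2 : (1 <= s2)%N) (hs : (s2 <= s1)%N) (hcop : coprime s1 s2)
    (hPQ : (P != 0) || (Q != 0))
    (hqh : quasi_homogeneous s1 s2 (P, Q))
    (hPstar : Pstar \is n.-homog) (hQstar : Qstar \is n.-homog)
    (hpull : same_foliation
               (pullback ('X_0 ^+ s2) ('X_1 ^+ s1) (Pstar, Qstar)) (P, Q)) :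
  has_center (P, Q) <->
    (odd s1 && odd s2 /\ has_center (Pstar, Qstar)) \/
    (odd s1 (+) odd s2 /\
      (has_center (Pstar, Qstar) \/ has_focus (Pstar, Qstar))).
Proof.
have s1_gt0 : (0 < s1)%N := leq_trans hs2 hs.
have not_both_even : odd s1 || odd s2.
  rewrite -[X in X || _]negbK -[X in _ || X]negbK -negb_and -!dvdn2.
  apply/negP => /andP[d1 d2]; have : (2 %| gcdn s1 s2)%N by rewrite dvdn_gcd d1 d2.
  by rewrite (eqP hcop).
have star_neq0 : (Pstar != 0) || (Qstar != 0).
  rewrite -negb_and; apply/negP => /andP[/eqP P0 /eqP Q0].
  move: hpull => [A [B [_ B0]]]; rewrite -/(power_pullback s1 s2 _).
  rewrite power_pullbackE P0 Q0 /= !raddf0 !mulr0 !scaler0 !mulr0.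
  move=> /esym/eqP; rewrite mulf_eq0 (negPf B0) /= => /eqP P00.
  move=> /esym/eqP; rewrite mulf_eq0 (negPf B0) /= => /eqP Q00.
  by move: hPQ; rewrite P00 Q00 eqxx.
have [m [w0 [h1 h2 red0 same]]] :=
  @homog_reduction R n (Pstar, Qstar) hPstar hQstar star_neq0.
have ww : same_foliation (P, Q) (power_pullback s1 s2 w0).
  exact: same_foliation_trans (same_foliation_sym hpull) (same s1 s2 s1_gt0 hs2).
have wstar : same_foliation (Pstar, Qstar) (power_pullback 1 1 w0).
  by have := same 1%N 1%N isT isT; rewrite power_pullback1.
(* If x q - y p has a zero off the origin, neither foliation has a center or a focus, so both sides
   of the equivalence fail. *)
have [mono|] := pselect (forall x y : R, 0 < x ^+ 2 + y ^+ 2 ->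
    x * evalxy w0.2 (x, y) - y * evalxy w0.1 (x, y) != 0); last first.
  move=> /existsNP[u /existsNP[v /not_implyP[uv0 /negP]]].
  rewrite negbK subr_eq0 => /eqP char.
  have no_center a b w : (0 < a)%N -> (0 < b)%N -> odd a || odd b ->
      same_foliation w (power_pullback a b w0) -> ~ has_center w /\ ~ has_focus w.
    move=> a0 b0 oab wab; split=> /all_leaves_exists[U [x [y [leaf C]]]];
      apply: (characteristic_no_winding h1 h2 red0 uv0 char a0 b0 oab wab leaf).
    - exact: closed_winds.
    - exact: spiral_winds.
  have [nc _] := no_center s1 s2 _ s1_gt0 hs2 not_both_even ww.
  have [ncs nfs] := no_center 1%N 1%N _ isT isT isT wstar.
  by split=> [/nc|[[_ /ncs]|[_ [/ncs|/nfs]]]].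
have p_hom l x y := evalxy_homog l x y h1; have q_hom l x y := evalxy_homog l x y h2.
have p_cont := @continuous_evalxy R w0.1; have q_cont := @continuous_evalxy R w0.2.
have [g1 [J1 gJ1]] := growth_potential_exists p_cont q_cont mono (ltn0Sn 0) (ltn0Sn 0).
have [g [J gJ]] := growth_potential_exists p_cont q_cont mono s1_gt0 hs2.
split=> [cen|[[oo cen]|[oo _]]].
- case: (boolP (odd s1 && odd s2)) => [/andP[h1odd h2odd] | nb].
    left; split=> //; apply: (zero_growth_center h1 h2 mono _ _ gJ1 _ wstar) => //.
    exact: (center_zero_growth h1 h2 mono h1odd h2odd gJ1 ww cen).
  (* For weights of opposite parity, [J1] alone decides: without invariant lines the homogeneous
     foliation is a center if [J1] is 0 and a focus otherwise. *)
  right; split; first by case: (odd s1) (odd s2) not_both_even nb => [] [].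
  have [J10|J10] := eqVneq J1 0.
    by left; apply: (zero_growth_center h1 h2 mono _ _ gJ1 _ wstar).
  by right; exact: (nonzero_growth_focus h1 h2 mono gJ1 J10 wstar).
- have /andP[h1odd h2odd] := oo.
  apply: (zero_growth_center h1 h2 mono s1_gt0 hs2 gJ _ ww).
  apply/(growth_odd p_hom q_hom p_cont q_cont mono h1odd h2odd gJ gJ1).
  exact: (center_zero_growth (a := 1) (b := 1) h1 h2 mono isT isT gJ1 wstar cen).
(* Opposite parity makes the growth of the pull-back vanish whatever [J1] is, so centers and foci
   both pull back to centers. *)
- apply: (zero_growth_center h1 h2 mono s1_gt0 hs2 gJ _ ww).
  exact: (growth_even p_hom q_hom p_cont q_cont mono s1_gt0 hs2 oo gJ).
Qed.
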